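(* Let $(C_1,C_2,C_3)$ be a configuration of three pairwise distinct circles of positive radius in the Euclidean plane. Let $n$ be the number of intersection points of the configuration, i.e. the number of points of the plane lying on at least two of the three circles, and let $N\in\{0,1,2,\dots\}\cup\{\infty\}$ be the number of solutions of Apollonius' problem for the configuration, i.e. the number of (unoriented) objects $D$, where $D$ is a circle of positive radius, a line, or a point (circle of radius zero), that are tangent to each of $C_1,C_2,C_3$. Then the configuration falls into exactly one of the following $17$ cases (all other combinations being impossible), and $N$ is as indicated: (1) The configuration contains a strictly separating circle: then $n=0$ and $N=0$. (2) There are no tangent circles, no double points, and no strictly separating circle: then $n\in\{0,2,4,6\}$, and $N=8$ if $n=0$; $N=4$ if $n=2$; $N=4$ if $n=4$; $N=8$ if $n=6$. (3) There are exactly one or two tangency points, no separating circle, and no double points: then $n\in\{1,2,3,4,5\}$, and $N=6$ if $n=1$; $N=5$ if $n=2$; $N=4$ if $n=3$; $N=5$ if $n=4$; $N=6$ if $n=5$. (4) There are three (distinct) tangency points: then $n=3$ and $N=5$. (5) There are tangent circles and a separating circle, and no double points: then $n\in\{1,2\}$, and $N=2$ if $n=1$; $N=3$ if $n=2$. (6) There are double points: then $n\in\{1,2,3,4\}$, and $N=\infty$ if $n=1$; $N=2$ if $n=2$; $N=3$ if $n=3$; $N=5$ if $n=4$. In particular, the maximal finite number of solutions is $8$, no configuration has exactly $7$ solutions, and no configuration has exactly one solution.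
   Context: Conventions and definitions. Two circles of positive radius are tangent if they meet in exactly one point; in addition a circle is regarded as tangent to itself (so that one of the $C_i$ may itself be a solution). A line is tangent to a circle of positive radius if it meets it in exactly one point. A point (circle of radius zero) is tangent to a circle of positive radius if it lies on it. ''Tangent circles'' in a configuration means that two of the (distinct) circles $C_1,C_2,C_3$ are tangent to each other; a ''tangency point'' is a point of contact of two tangent circles of the configuration. An intersection point of the configuration is called a double point if it belongs to all three circles. The circle $C_i$ of the configuration is strictly separating if the other two circles are contained in distinct connected components of the plane minus $C_i$. The circle $C_i$ is separating (in the wide sense) if the other two circles are contained in the closures of distinct connected components of the plane minus $C_i$. *)

(* Defs.v *)
From HB Require Import structures.
From mathcomp Require Import all_boot all_order all_algebra.
From mathcomp Require Import all_classical all_reals all_analysis.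
Set Implicit Arguments.
Unset Strict Implicit.
Unset Printing Implicit Defensive.
Import Order.TTheory GRing.Theory Num.Theory.
Import numFieldNormedType.Exports.
Local Open Scope classical_set_scope.
Local Open Scope card_scope.
Local Open Scope ring_scope.

(* R * R carries the Euclidean topology, but its canonical norm is the max
   norm, hence the explicit Euclidean distance. *)
Definition edist (R : realType) (p q : R * R) : R :=
  Num.sqrt ((p.1 - q.1) ^+ 2 + (p.2 - q.2) ^+ 2).

(* Circles, lines and points are all taken as subsets of the plane, so that
   equality and counting of objects do not depend on equations or parameters. *)
Definition is_circle (R : realType) (D : set (R * R)) : Prop :=
  exists (c : R * R) (r : R), 0 < r /\ D = [set p | edist p c = r].

Definition is_line (R : realType) (D : set (R * R)) : Prop :=
  exists a b c : R, (a, b) <> (0, 0) /\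
    D = [set p | a * p.1 + b * p.2 = c].

Definition meet_once (R : realType) (D E : set (R * R)) : Prop :=
  exists! p, (D `&` E) p.

(* In the tangency predicates, E is a circle of positive radius. *)
Definition circle_tangent (R : realType) (D E : set (R * R)) : Prop :=
  is_circle D /\ (D = E \/ meet_once D E).

Definition line_tangent (R : realType) (D E : set (R * R)) : Prop :=
  is_line D /\ meet_once D E.

Definition point_tangent (R : realType) (D E : set (R * R)) : Prop :=
  exists p : R * R, D = [set p] /\ E p.

Definition tangent (R : realType) (D E : set (R * R)) : Prop :=
  [\/ circle_tangent D E, line_tangent D E | point_tangent D E].

Definition configuration (R : realType) (C : 'I_3 -> set (R * R)) : Prop :=
  (forall i, is_circle (C i)) /\ injective C.

Definition solutions (R : realType) (C : 'I_3 -> set (R * R)) :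
    set (set (R * R)) :=
  [set D | forall i, tangent D (C i)].

Definition intersection_points (R : realType) (C : 'I_3 -> set (R * R)) :
    set (R * R) :=
  [set p | exists i j, [/\ i <> j, C i p & C j p]].

Definition double_points (R : realType) (C : 'I_3 -> set (R * R)) :
    set (R * R) :=
  [set p | forall i, C i p].

Definition tangency_points (R : realType) (C : 'I_3 -> set (R * R)) :
    set (R * R) :=
  [set p | exists i j, [/\ i <> j, circle_tangent (C i) (C j), C i p & C j p]].

Definition has_tangent_circles (R : realType) (C : 'I_3 -> set (R * R)) : Prop :=
  exists i j, i <> j /\ circle_tangent (C i) (C j).

Definition has_double_points (R : realType) (C : 'I_3 -> set (R * R)) : Prop :=
  double_points C !=set0.

Definition is_component (R : realType) (A U : set (R * R)) : Prop :=
  exists x, A x /\ U = connected_component A x.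

Definition strictly_separating (R : realType) (C : 'I_3 -> set (R * R))
    (i : 'I_3) : Prop :=
  exists j k, [/\ j <> i, k <> i & j <> k] /\
  exists U V, [/\ is_component (~` C i) U, is_component (~` C i) V, U <> V,
                  C j `<=` U & C k `<=` V].

Definition separating (R : realType) (C : 'I_3 -> set (R * R))
    (i : 'I_3) : Prop :=
  exists j k, [/\ j <> i, k <> i & j <> k] /\
  exists U V, [/\ is_component (~` C i) U, is_component (~` C i) V, U <> V,
                  C j `<=` closure U & C k `<=` closure V].

Inductive kind : Type :=
  | Separated
  | NoTangency
  | OneOrTwoTangencies
  | ThreeTangencies
  | SeparatedTangent
  | WithDoublePoints.

Definition of_kind (R : realType) (C : 'I_3 -> set (R * R)) (k : kind) : Prop :=
  match k with
  | Separated => exists i, strictly_separating C i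
  | NoTangency =>
      [/\ ~ has_tangent_circles C, ~ has_double_points C
        & ~ exists i, strictly_separating C i]
  | OneOrTwoTangencies =>
      [/\ (tangency_points C #= `I_1) \/ (tangency_points C #= `I_2),
          ~ (exists i, separating C i) & ~ has_double_points C]
  | ThreeTangencies => tangency_points C #= `I_3
  | SeparatedTangent =>
      [/\ has_tangent_circles C, exists i, separating C i
        & ~ has_double_points C]
  | WithDoublePoints => has_double_points C
  end.

(* [None] stands for an infinite cardinal. *)
Definition has_number (T : Type) (A : set T) (N : option nat) : Prop :=
  match N with
  | Some m => A #= `I_m
  | None => infinite_set A
  end.

(* A kind of configuration, a number n of intersection points, and the
   corresponding number N of solutions. *)
Record apollonius_case : Type := Case {
  case_kind : kind;
  case_n : nat;
  case_N : option nat
}.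

Definition apollonius_cases : 17.-tuple apollonius_case :=
  [tuple Case Separated          0 (Some 0%N);

         Case NoTangency         0 (Some 8%N);
         Case NoTangency         2 (Some 4%N);
         Case NoTangency         4 (Some 4%N);
         Case NoTangency         6 (Some 8%N);

         Case OneOrTwoTangencies 1 (Some 6%N);
         Case OneOrTwoTangencies 2 (Some 5%N);
         Case OneOrTwoTangencies 3 (Some 4%N);
         Case OneOrTwoTangencies 4 (Some 5%N);
         Case OneOrTwoTangencies 5 (Some 6%N);

         Case ThreeTangencies    3 (Some 5%N);

         Case SeparatedTangent   1 (Some 2%N);
         Case SeparatedTangent   2 (Some 3%N);

         Case WithDoublePoints   1 None;
         Case WithDoublePoints   2 (Some 2%N);
         Case WithDoublePoints   3 (Some 3%N);
         Case WithDoublePoints   4 (Some 5%N)].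

Definition falls_into (R : realType) (C : 'I_3 -> set (R * R))
    (x : apollonius_case) : Prop :=
  of_kind C (case_kind x) /\ intersection_points C #= `I_(case_n x).

(* Main.v *)
Require Import Defs.
From HB Require Import structures.
From mathcomp Require Import all_boot all_order all_algebra.
From mathcomp Require Import all_classical all_reals all_analysis.
From mathcomp Require Import ring lra zify.
Set Implicit Arguments.
Unset Strict Implicit.
Unset Printing Implicit Defensive.
Import Order.TTheory GRing.Theory Num.Theory.
Import numFieldNormedType.Exports.
Local Open Scope classical_set_scope.
Local Open Scope ring_scope.

(** Fix one of the circles, with center o and radius r. A circle or line
    touching it is encoded by a lightlike vector v = (u, a, b), a^2 + b^2 = u^2
    (an affine chart of Lie's coordinates for oriented circles). It touches
    another circle, of radius s and with center at squared distance d, iff v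
    lies on one of two parallel planes n.v = g, where g = (r - s)^2 - d or
    g = (r + s)^2 - d. The solutions that are not points are therefore the
    intersections of the light cone with four lines, one for each choice of
    relative orientations. By Lagrange's identity the quadratic equation on
    such a line has discriminant - 4 r^2 g12 g13 g23, so that the line
    contributes 2, 1 or 0 solutions according to the sign of the product of the
    three gaps. The equation degenerates, because the direction of the line is
    lightlike, exactly when there is a double point.

    Without double points the number of solutions thus depends only on the
    relative positions of the pairs of circles. The triangle inequality makes
    nesting transitive and makes disjointness pass to nested circles, strictly
    so because a limiting tangency would be a double point; a check of the
    finitely many remaining tables of positions proves the classification. With
    a double point p, two of the circles are tangent iff their centers are
    collinear with p, which leaves four cases. *)

(** * Light cone and lines *)

(** In this chart [v = (u, a, b)] stands for the signed radius [q = r / (u + 1)] and the center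
    [o - q (a, b)]. Since [q u = r - q], being lightlike says that the center is at distance
    [|r - q|] from [o], which is oriented contact with the base circle. The sign of [q] is an
    orientation, and an object touching the base circle has only one orientation that agrees with
    it; so the four pairs of relative orientations count each unoriented object once. Points have
    [q = 0], lie at infinity on the cone, and are counted apart.

    The obstacle is degeneration. A line with lightlike direction is parallel to a generator of the
    cone; the generators correspond to the points of the base circle, and one that is orthogonal to
    both normals gives a point of all three circles. Parallel normals mean that the circles belong
    to a pencil, and then there is no line at all: the two equations are inconsistent unless there
    is a tangency, and without a double point the sign of the product of the gaps still predicts
    zero solutions. *)

Definition enumerates (T : eqType) (s : seq T) (A : set T) : Prop :=
  uniq s /\ forall x, A x <-> x \in s.

Lemma enumerates_card (T : eqType) (s : seq T) (A : set T) :
  enumerates s A -> (A #= `I_(size s))%card.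
Proof.
move=> [us As]; case: (posnP (size s)) => [/size0nil s0|s0].
  rewrite s0 II0 card_eq0; apply/eqP/seteqP; split=> // x /As.
  by rewrite s0.
have [x0 _] : exists x0, x0 \in s.
  by case: s s0 {us As} => // x0 s' _; exists x0; rewrite mem_head.
have -> : A = nth x0 s @` `I_(size s).
  apply/seteqP; split=> x /=.
    move=> /As xs; exists (index x s); rewrite ?nth_index //.
    by rewrite /= index_mem.
  by case=> i /= ilt <-; apply/As/mem_nth.
apply: inj_card_eq => i j; rewrite !inE /= => ilt jlt /eqP.
by rewrite nth_uniq // => /eqP.
Qed.

Lemma enumerates_cat (T : eqType) (s t : seq T) (A B : set T) :
  enumerates s A -> enumerates t B -> (forall x, A x -> ~ B x) ->
  enumerates (s ++ t) (A `|` B).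
Proof.
move=> [us As] [ut Bt] AB; split.
  rewrite cat_uniq us ut andbT /=; apply/hasPn => x /Bt Bx.
  by apply/negP => /As /AB.
move=> x; rewrite mem_cat /=; split.
  by case=> [/As ->//|/Bt ->]; rewrite orbT.
by case/orP => [/As|/Bt]; [left|right].
Qed.

Lemma enumerates_nil (T : eqType) (A : set T) :
  (forall x, ~ A x) -> enumerates [::] A.
Proof. by move=> nA; split=> // x; split=> // /nA. Qed.

Definition nroots (R : realType) (D : R) : nat := (0 <= D)%R + (0 < D)%R.

Lemma quadratic_roots (R : realType) (a b c : R) : a != 0 ->
  exists s, enumerates s [set t | a * t ^+ 2 + b * t *+ 2 + c = 0] /\
    size s = nroots (b ^+ 2 - a * c).
Proof.
move=> a0; rewrite /nroots.
have E t : a * t ^+ 2 + b * t *+ 2 + c = 0 <->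
    (a * t + b) ^+ 2 = b ^+ 2 - a * c.
  split=> [h|h].
    by rewrite -[RHS]addr0 -[0](mulr0 a) -h; ring.
  by apply: (mulfI a0); rewrite mulr0; move: h; lra.
case: ltgtP => [D0|D0|D0].
- pose h := Num.sqrt (b ^+ 2 - a * c).
  have h0 : 0 < h by rewrite sqrtr_gt0.
  exists [:: (- b + h) / a; (- b - h) / a]; split => //; split.
    rewrite /= inE andbT; apply/negP => /eqP /(mulIf (invr_neq0 a0)); lra.
  move=> t /=; rewrite E !inE -(sqr_sqrtr (ltW D0)) -/h; split.
    move=> /eqP; rewrite eqf_sqr => /orP[]/eqP e; apply/orP; [left|right];
      apply/eqP; apply: (mulIf a0); rewrite divfK // -e; ring.
  by case/orP => /eqP ->; field.
- exists [::]; split=> //; apply: enumerates_nil => t /=.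
  by rewrite E => e; move: D0; rewrite -e ltNge sqr_ge0.
- exists [:: - b / a]; split=> //; split=> // t /=.
  rewrite E -D0 inE; split.
    move/eqP; rewrite sqrf_eq0 => /eqP e; apply/eqP; apply: (mulIf a0).
    by rewrite divfK //; lra.
  by move=> /eqP ->; field.
Qed.

Definition dot3 (R : realType) (n v : R * R * R) : R :=
  n.1.1 * v.1.1 + n.1.2 * v.1.2 + n.2 * v.2.

Definition cross3 (R : realType) (n m : R * R * R) : R * R * R :=
  (n.1.2 * m.2 - n.2 * m.1.2, n.2 * m.1.1 - n.1.1 * m.2,
   n.1.1 * m.1.2 - n.1.2 * m.1.1).

Definition lor3 (R : realType) (v w : R * R * R) : R :=
  v.1.2 * w.1.2 + v.2 * w.2 - v.1.1 * w.1.1.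

Lemma triple_eq (R : realType) (v w : R * R * R) :
  v.1.1 = w.1.1 -> v.1.2 = w.1.2 -> v.2 = w.2 -> v = w.
Proof. by case: v => [[? ?] ?]; case: w => [[? ?] ?] /= -> -> ->. Qed.

Lemma dot3_gt0 (R : realType) (w : R * R * R) : w <> 0 -> 0 < dot3 w w.
Proof.
move=> w0; rewrite /dot3 lt_neqAle; apply/andP; split; last first.
  by rewrite -!expr2 !addr_ge0 // sqr_ge0.
apply/eqP => /esym/eqP; rewrite -!expr2 paddr_eq0 ?addr_ge0 ?sqr_ge0 //.
rewrite paddr_eq0 ?sqr_ge0 // !sqrf_eq0 => /andP[/andP[/eqP a /eqP b] /eqP c].
by apply: w0; apply: triple_eq.
Qed.

Definition lin3 (R : realType) (a : R) (v : R * R * R) (b : R)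
    (w : R * R * R) : R * R * R :=
  (a * v.1.1 + b * w.1.1, a * v.1.2 + b * w.1.2, a * v.2 + b * w.2).

Lemma planes_line (R : realType) (n m : R * R * R) (g h : R) :
  cross3 n m <> 0 ->
  exists v0, forall v, (dot3 n v = g /\ dot3 m v = h) <->
    exists t, v = lin3 1 v0 t (cross3 n m).
Proof.
move=> /dot3_gt0/lt0r_neq0; set w := cross3 n m => W1.
(* The vector [cross3 m w] is orthogonal to [m] and its product with [n] is [dot3 w w]; [cross3 w n]
   does the same with [n] and [m] exchanged. *)
exists (lin3 (g / dot3 w w) (cross3 m w) (h / dot3 w w) (cross3 w n)) => v.
move: W1; rewrite /lin3 /dot3 /w /cross3 /= => W1; split.
  move=> [<- <-]; exists (dot3 w v / dot3 w w).
  by apply: triple_eq; rewrite /dot3 /w /cross3 /=; field; exact: W1.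
by case=> t ->; rewrite /=; split; field; exact: W1.
Qed.

Lemma lor3_lin3 (R : realType) (v w : R * R * R) (t : R) :
  lor3 (lin3 1 v t w) (lin3 1 v t w) =
  lor3 w w * t ^+ 2 + lor3 v w * t *+ 2 + lor3 v v.
Proof. rewrite /lor3 /lin3 /=; ring. Qed.

(* Lagrange's identity for the Lorentz form. *)
Lemma lor3_cross3 (R : realType) (n m v : R * R * R) :
  lor3 v (cross3 n m) ^+ 2 - lor3 (cross3 n m) (cross3 n m) * lor3 v v =
  lor3 (lin3 (dot3 n v) m (- dot3 m v) n) (lin3 (dot3 n v) m (- dot3 m v) n).
Proof. rewrite /lor3 /lin3 /cross3 /dot3 /=; ring. Qed.

Lemma lin3_inj (R : realType) (v w : R * R * R) :
  w <> 0 -> injective (fun t => lin3 1 v t w).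
Proof.
move=> /dot3_gt0/lt0r_neq0 w0 t t' [] e1 e2 e3.
apply/eqP; rewrite -subr_eq0; apply/eqP/(mulIf w0); rewrite mul0r /dot3.
have -> : (t - t') * (w.1.1 * w.1.1 + w.1.2 * w.1.2 + w.2 * w.2) =
  ((1 * v.1.1 + t * w.1.1) - (1 * v.1.1 + t' * w.1.1)) * w.1.1 +
  ((1 * v.1.2 + t * w.1.2) - (1 * v.1.2 + t' * w.1.2)) * w.1.2 +
  ((1 * v.2 + t * w.2) - (1 * v.2 + t' * w.2)) * w.2 by ring.
by rewrite e1 e2 e3 !subrr !mul0r !addr0.
Qed.

Definition light_on (R : realType) (n m : R * R * R) (g h : R) :
    set (R * R * R) :=
  [set v | [/\ lor3 v v = 0, dot3 n v = g & dot3 m v = h]].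

Lemma enumerates_map (T U : eqType) (f : T -> U) (s : seq T) (A : set T)
    (B : set U) : (forall x y, A x -> A y -> f x = f y -> x = y) ->
  enumerates s A -> (forall y, B y <-> exists2 x, A x & y = f x) ->
  enumerates (map f s) B.
Proof.
move=> f_inj [us As] BE; split.
  by rewrite map_inj_in_uniq // => x y /As Ax /As Ay; exact: f_inj.
move=> y; split=> [/BE[x /As xs ->]|/mapP[x /As xs ->]]; first exact: map_f.
by apply/BE; exists x.
Qed.

Lemma enumerates_exists1 (T : eqType) (s : seq T) (A : set T) :
  enumerates s A -> (exists! x, A x) <-> size s = 1%N.
Proof.
move=> [us As]; split=> [[x [/As xs x1]]|].
  apply/eqP; rewrite eqn_leq -[X in (_ <= X)%N && _]/(size [:: x]).
  rewrite uniq_leq_size //= => [|y /As /x1 ->]; last by rewrite mem_head.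
  by case: s xs {us As x1}.
case: s us As => [|x []] // _ As _; exists x; split; first by apply/As; rewrite mem_head.
by move=> y /As; rewrite inE => /eqP.
Qed.

(** The base point [v0] can stay abstract: only its values on the two normals enter the
    discriminant, through Lagrange's identity. *)
Lemma light_onE (R : realType) (n m : R * R * R) (g h : R) :
  cross3 n m <> 0 -> exists v0, [/\ dot3 n v0 = g, dot3 m v0 = h &
  forall s, enumerates s [set t | lor3 (cross3 n m) (cross3 n m) * t ^+ 2 +
    lor3 v0 (cross3 n m) * t *+ 2 + lor3 v0 v0 = 0] ->
  enumerates (map (fun t => lin3 1 v0 t (cross3 n m)) s) (light_on n m g h)].
Proof.
move=> w0; have [v0 v0P] := planes_line g h w0; exists v0.
have [|h1 h2] := (v0P v0).2.
  exists 0; apply: triple_eq; rewrite /lin3 /=; ring.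
split=> // s sP; apply: (enumerates_map _ sP) => [x y _ _ /lin3_inj|v]; [exact|split].
  move=> [vv vn vm]; have [t vE] := (v0P v).1 (conj vn vm).
  by exists t; rewrite // /= -lor3_lin3 -vE.
move=> [t /= tE vE]; have [vn vm] := (v0P v).2 (ex_intro _ t vE).
by split=> //; rewrite vE lor3_lin3.
Qed.

Lemma light_on_count (R : realType) (n m : R * R * R) (g h : R) :
  lor3 (cross3 n m) (cross3 n m) != 0 ->
  exists s, enumerates s (light_on n m g h) /\
    size s = nroots (lor3 (lin3 g m (- h) n) (lin3 g m (- h) n)).
Proof.
move=> ww0; have w0 : cross3 n m <> 0.
  by move=> w0; move: ww0; rewrite w0 /lor3 /= !mulr0 addr0 subrr eqxx.
have [v0 [v0n v0m v0P]] := light_onE g h w0.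
have [s [sP ss]] := quadratic_roots (lor3 v0 (cross3 n m)) (lor3 v0 v0) ww0.
exists (map (fun t => lin3 1 v0 t (cross3 n m)) s).
by split; [exact: v0P|rewrite size_map ss lor3_cross3 v0n v0m].
Qed.

Lemma light_neq0 (R : realType) (w : R * R * R) :
  w <> 0 -> lor3 w w = 0 -> w.1.1 != 0.
Proof.
move=> w0 ww; apply/eqP => w1; apply: w0; move: ww.
rewrite /lor3 w1 mul0r subr0 -!expr2 => /eqP.
rewrite paddr_eq0 ?sqr_ge0 // !sqrf_eq0 => /andP[/eqP w2 /eqP w3].
exact: triple_eq.
Qed.

(** A Lorentz form in dimension 3 has no totally isotropic plane: the squares of the two defects of
    proportionality add up to a combination of the three vanishing products. *)
Lemma light_parallel (R : realType) (v w : R * R * R) :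
  lor3 v v = 0 -> lor3 w w = 0 -> lor3 v w = 0 ->
  w.1.1 * v.1.2 = v.1.1 * w.1.2 /\ w.1.1 * v.2 = v.1.1 * w.2.
Proof.
move=> vv ww vw; pose x := w.1.1 * v.1.2 - v.1.1 * w.1.2.
pose y := w.1.1 * v.2 - v.1.1 * w.2.
have : x ^+ 2 + y ^+ 2 == 0.
  have -> : x ^+ 2 + y ^+ 2 = w.1.1 ^+ 2 * lor3 v v + v.1.1 ^+ 2 * lor3 w w
    - 2 * v.1.1 * w.1.1 * lor3 v w by rewrite /x /y /lor3; ring.
  by rewrite vv ww vw !mulr0 addr0 subr0.
rewrite paddr_eq0 ?sqr_ge0 // !sqrf_eq0 !subr_eq0.
by move=> /andP[/eqP -> /eqP ->].
Qed.

Lemma dot3_cross3 (R : realType) (n m : R * R * R) :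
  dot3 n (cross3 n m) = 0 /\ dot3 m (cross3 n m) = 0.
Proof. by rewrite /dot3 /cross3 /=; split; ring. Qed.

(* When the direction of the line is itself lightlike, the quadratic
   equation degenerates to a linear one. *)
Lemma light_on_count1 (R : realType) (n m : R * R * R) (g h : R) :
  cross3 n m <> 0 -> lor3 (cross3 n m) (cross3 n m) = 0 ->
  (g, h) <> (0, 0) ->
  exists s, enumerates s (light_on n m g h) /\
    size s = (lor3 (lin3 g m (- h) n) (lin3 g m (- h) n) != 0) :> nat.
Proof.
move=> w0 ww0 gh0; have [v0 [v0n v0m v0P]] := light_onE g h w0.
have D := lor3_cross3 n m v0; rewrite v0n v0m ww0 mul0r subr0 in D.
rewrite -D sqrf_eq0; have [e|e] := eqVneq (lor3 v0 (cross3 n m)) 0.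
  exists [::]; split=> //.
  apply: (v0P [::]); apply: enumerates_nil => t /=.
  (* With zero slope, a root makes [v0] lightlike and orthogonal to the direction, hence parallel to
     it. The direction is annihilated by both normals, so [g = h = 0]. *)
  rewrite ww0 e !mul0r mul0rn !add0r => v00; apply: gh0.
  have [nw mw] := dot3_cross3 n m.
  have [p2 p3] := light_parallel v00 ww0 e.
  have w1 := light_neq0 w0 ww0.
  have dotE k : (cross3 n m).1.1 * dot3 k v0 = v0.1.1 * dot3 k (cross3 n m).
    transitivity (k.1.1 * ((cross3 n m).1.1 * v0.1.1) +
      k.1.2 * ((cross3 n m).1.1 * v0.1.2) + k.2 * ((cross3 n m).1.1 * v0.2)).
      by rewrite /dot3; ring.
    by rewrite p2 p3 /dot3; ring.
  by congr pair; apply: (mulfI w1); rewrite mulr0 -?v0n -?v0m dotE ?nw ?mw mulr0.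
set B := lor3 v0 _ in e *.
have B2 : 2 * B != 0 by rewrite mulf_neq0 // pnatr_eq0.
exists [:: lin3 1 v0 (- lor3 v0 v0 / (2 * B)) (cross3 n m)]; split => //.
apply: (v0P [:: - lor3 v0 v0 / (2 * B)]); split=> // t /=.
rewrite ww0 mul0r add0r inE -/B; split=> [h0|/eqP ->]; last by field.
by apply/eqP; apply: (mulIf B2); rewrite divfK //; move: h0; lra.
Qed.

(** * Gaps and oriented contact *)

(* [gap false] vanishes for internal, [gap true] for external tangency of two
   circles with radii [r], [s] and squared distance [d] of the centers. *)
Definition gap (R : realType) (b : bool) (r s d : R) : R :=
  (if b then r + s else r - s) ^+ 2 - d.

(** Contact with the circle of radius [s] around [o + (x, y)] reads
    [|(x, y) + q (a, b)|^2 = (q -+ s)^2] with [q = r / (u + 1)]. The relation [q u = r - q] removes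
    the squares of [q], and multiplication by [u + 1] leaves the product of this vector with [v]
    equal to [(r -+ s)^2 - d]. *)
Definition nvec (R : realType) (r x y s : R) : R * R * R :=
  (x ^+ 2 + y ^+ 2 - s ^+ 2 + r ^+ 2, 2 * r * x, 2 * r * y).

(** Heron's formula: this is 16 times the squared area of a triangle whose sides are [r], [s] and
    the distance of the centers. The normal is spacelike, lightlike or timelike as the circles
    cross, touch or miss each other. *)
Lemma lor3_nvec (R : realType) (b : bool) (r x y s : R) :
  lor3 (nvec r x y s) (nvec r x y s) =
  - (gap b r s (x ^+ 2 + y ^+ 2) * gap (~~ b) r s (x ^+ 2 + y ^+ 2)).
Proof. by rewrite /lor3 /nvec /gap; case: b => /=; ring. Qed.

(** Evaluates the right-hand side of Lagrange's identity. Orientations relative to the base circle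
    fix the relative orientation of the other two circles, hence [b (+) b']. *)
Lemma lor3_gap (R : realType) (b b' : bool) (r x y s x' y' s' : R) :
  let v := lin3 (gap b r s (x ^+ 2 + y ^+ 2)) (nvec r x' y' s')
    (- gap b' r s' (x' ^+ 2 + y' ^+ 2)) (nvec r x y s) in
  lor3 v v = (2 * r) ^+ 2 * - (gap b r s (x ^+ 2 + y ^+ 2) *
    gap b' r s' (x' ^+ 2 + y' ^+ 2) *
    gap (b (+) b') s s' ((x - x') ^+ 2 + (y - y') ^+ 2)).
Proof. by rewrite /lor3 /lin3 /nvec /gap; case: b; case: b' => /=; ring. Qed.

Lemma nroots_pM (R : realType) (k D : R) : 0 < k -> nroots (k * D) = nroots D.
Proof. by move=> k0; rewrite /nroots pmulr_rge0 // pmulr_rgt0. Qed.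

(** Generators of the cone are points of the base circle: the objects of [t (- r, X, Y)] shrink, as
    [t] grows, to the point at offset [(X, Y)]. *)
Lemma light_point (R : realType) (r x y s X Y : R) : 0 < r ->
  X ^+ 2 + Y ^+ 2 = r ^+ 2 ->
  (X - x) ^+ 2 + (Y - y) ^+ 2 = s ^+ 2 <->
  dot3 (nvec r x y s) (- r, X, Y) = 0.
Proof.
move=> r0 XY.
have -> : dot3 (nvec r x y s) (- r, X, Y) =
  r * (s ^+ 2 - ((X - x) ^+ 2 + (Y - y) ^+ 2)).
  have -> : (X - x) ^+ 2 + (Y - y) ^+ 2 =
    r ^+ 2 - 2 * (X * x + Y * y) + x ^+ 2 + y ^+ 2 by rewrite -XY; ring.
  by rewrite /dot3 /nvec /=; ring.
split=> [->|/eqP]; first by rewrite subrr mulr0.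
by rewrite mulf_eq0 gt_eqF //= subr_eq0 => /eqP.
Qed.

Lemma light_scale (R : realType) (v : R * R * R) (r : R) :
  v <> 0 -> lor3 v v = 0 ->
  let X := - r * v.1.2 / v.1.1 in let Y := - r * v.2 / v.1.1 in
  X ^+ 2 + Y ^+ 2 = r ^+ 2 /\
  forall n, dot3 n v = 0 -> dot3 n (- r, X, Y) = 0.
Proof.
move=> v0 vv; have v1 := light_neq0 v0 vv; split=> [|n nv].
  have e : v.1.2 ^+ 2 + v.2 ^+ 2 = v.1.1 ^+ 2.
    by move: vv; rewrite /lor3; lra.
  rewrite !expr_div_n !exprMn -mulrDl -mulrDr e sqrrN mulfK //.
  by rewrite sqrf_eq0.
transitivity (- r / v.1.1 * dot3 n v); last by rewrite nv mulr0.
by rewrite /dot3 /=; field.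
Qed.

Definition common3 (R : realType) (r x y s x' y' s' X Y : R) : Prop :=
  [/\ X ^+ 2 + Y ^+ 2 = r ^+ 2, (X - x) ^+ 2 + (Y - y) ^+ 2 = s ^+ 2 &
      (X - x') ^+ 2 + (Y - y') ^+ 2 = s' ^+ 2].

Lemma light_common3 (R : realType) (r x y s x' y' s' : R) (v : R * R * R) :
  0 < r -> v <> 0 -> lor3 v v = 0 -> dot3 (nvec r x y s) v = 0 ->
  dot3 (nvec r x' y' s') v = 0 -> exists X Y, common3 r x y s x' y' s' X Y.
Proof.
move=> r0 v0 vv nv mv; have [XY dotP] := light_scale r v0 vv.
by do 2 eexists; split; [exact: XY| |]; apply/(light_point _ _ _ r0 XY)/dotP.
Qed.

Lemma parallel3 (R : realType) (n m : R * R * R) : n <> 0 ->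
  cross3 n m = 0 -> exists l, m = lin3 l n 0 n.
Proof.
move=> /dot3_gt0/lt0r_neq0 n0 [] c1 c2 c3; exists (dot3 n m / dot3 n n).
move: n0; rewrite /dot3 => n0.
apply: triple_eq; apply: (mulfI n0); rewrite /= mul0r addr0 [RHS]mulrA
  [_ * (_ / _)]mulrC divfK //; apply/eqP; rewrite -subr_eq0; apply/eqP.
- transitivity (n.2 * (n.2 * m.1.1 - n.1.1 * m.2) -
    n.1.2 * (n.1.1 * m.1.2 - n.1.2 * m.1.1)); first by ring.
  by rewrite c2 c3 !mulr0 subr0.
- transitivity (n.1.1 * (n.1.1 * m.1.2 - n.1.2 * m.1.1) -
    n.2 * (n.1.2 * m.2 - n.2 * m.1.2)); first by ring.
  by rewrite c1 c3 !mulr0 subr0.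
- transitivity (n.1.2 * (n.1.2 * m.2 - n.2 * m.1.2) -
    n.1.1 * (n.2 * m.1.1 - n.1.1 * m.2)); first by ring.
  by rewrite c1 c2 !mulr0 subr0.
Qed.

Lemma spacelike_orth_light (R : realType) (n : R * R * R) : n <> 0 ->
  0 <= lor3 n n -> exists v, [/\ v <> 0, lor3 v v = 0 & dot3 n v = 0].
Proof.
move=> n0; rewrite /lor3 => nn; pose m := n.1.2 ^+ 2 + n.2 ^+ 2.
have m0 : m != 0.
  apply/negP => /eqP m0; apply: n0; move: (m0) => /eqP.
  rewrite paddr_eq0 ?sqr_ge0 // !sqrf_eq0 => /andP[/eqP n2 /eqP n3].
  apply: triple_eq => //; move: nn.
  rewrite n2 n3 !mulr0 addr0 sub0r oppr_ge0 -expr2 => nn; apply/eqP.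
  by rewrite -sqrf_eq0 eq_le nn sqr_ge0.
pose h := Num.sqrt (m - n.1.1 ^+ 2).
have hE : h ^+ 2 = m - n.1.1 ^+ 2.
  by rewrite sqr_sqrtr // /m; move: nn; rewrite -!expr2.
(* With first coordinate 1 the other two form a unit vector on the line [n.1.2 a + n.2 b = - n.1.1].
   This line is at distance at most 1 from the origin because [n] is not timelike, and [h] is the
   half chord up to scaling. *)
exists (1, (- n.1.1 * n.1.2 - h * n.2) / m, (- n.1.1 * n.2 + h * n.1.2) / m).
split.
- by case=> /eqP; rewrite oner_eq0.
- rewrite /lor3 /=; transitivity ((n.1.1 ^+ 2 + h ^+ 2) / m - 1).
    by rewrite /m; field.
  by rewrite hE (addrC (n.1.1 ^+ 2)) subrK divff // subrr.
- by rewrite /dot3 /= /m; field.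
Qed.

(* Three distinct circles of a pencil without a tangency have inconsistent
   oriented contact equations. *)
Lemma coaxial_inconsistent (R : realType) (b b' : bool)
    (r x y s x' y' s' l : R) :
  0 < r -> 0 < s -> 0 < s' ->
  (x', y', s') <> (0, 0, r) -> (x, y, s) <> (x', y', s') ->
  lor3 (nvec r x y s) (nvec r x y s) != 0 ->
  nvec r x' y' s' = lin3 l (nvec r x y s) 0 (nvec r x y s) ->
  gap b' r s' (x' ^+ 2 + y' ^+ 2) != l * gap b r s (x ^+ 2 + y ^+ 2).
Proof.
move=> r0 s0 s0' neq0 neq N0 nE; apply/eqP => gE.
have r1 := lt0r_neq0 r0.
have [kE xE yE] : [/\ x' ^+ 2 + y' ^+ 2 - s' ^+ 2 + r ^+ 2 =
    l * (x ^+ 2 + y ^+ 2 - s ^+ 2 + r ^+ 2), x' = l * x & y' = l * y].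
  case: nE; rewrite !mul0r !addr0 => e1 e2 e3; split=> //.
    by apply: (@mulfI _ (2 * r)); [rewrite mulf_neq0 // pnatr_eq0|rewrite e2; ring].
  by apply: (@mulfI _ (2 * r)); [rewrite mulf_neq0 // pnatr_eq0|rewrite e3; ring].
have N1 : lor3 (nvec r x' y' s') (nvec r x' y' s') =
    l ^+ 2 * lor3 (nvec r x y s) (nvec r x y s).
  by rewrite nE /lor3 /lin3 /=; ring.
have g0 : gap b r s (x ^+ 2 + y ^+ 2) != 0.
  by apply: contra_neq N0 => g0; rewrite (lor3_nvec b) g0 mul0r oppr0.
have [l0|l0] := eqVneq l 0.
  move: kE; rewrite xE yE l0 !mul0r !expr0n /= addr0 sub0r => /eqP.
  rewrite addrC subr_eq0 eqf_sqr => /orP[/eqP e|/eqP e]; last by lra.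
  by apply: neq0; rewrite xE yE l0 !mul0r e.
pose sg (c : bool) : R := if c then -1 else 1.
have sg2 c : sg c ^+ 2 = 1 by case: c; rewrite /sg ?sqrrN expr1n.
have gapE c u d : gap c r u d = (r - sg c * u) ^+ 2 - d.
  by rewrite /gap /sg; case: c; ring.
have gapN c u d : gap (~~ c) r u d = gap c r u d + 4 * r * (sg c * u).
  by rewrite !gapE /sg; case: c => /=; ring.
(* The product of the two gaps scales by [l^2] and one of them by [l], so the other one scales by
   [l] too; their difference is [4 r] times the signed radius. Thus the third circle is the image of
   the second under the homothety of ratio [l] about the base center. *)
have sE : sg b' * s' = l * (sg b * s).
  have h : gap (~~ b') r s' (x' ^+ 2 + y' ^+ 2) =
      l * gap (~~ b) r s (x ^+ 2 + y ^+ 2).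
    apply: (@mulfI _ (l * gap b r s (x ^+ 2 + y ^+ 2))); first exact: mulf_neq0.
    rewrite -{1}gE; apply: oppr_inj; rewrite -(lor3_nvec b') N1 (lor3_nvec b).
    ring.
  move: h; rewrite !gapN gE => h; apply: (@mulfI _ (4 * r)).
    by rewrite mulf_neq0 // pnatr_eq0.
  by move: h; lra.
have s'2 : s' ^+ 2 = l ^+ 2 * s ^+ 2.
  rewrite -[LHS]mul1r -(sg2 b') -exprMn sE !exprMn sg2 mul1r //.
have [l1|l1] := eqVneq l 1.
  apply: neq; rewrite xE yE l1 !mul1r; congr (_, _, _).
  by move: sE; rewrite l1 mul1r /sg; case: (b); case: (b') => /=; lra.
have dE : l * (x ^+ 2 + y ^+ 2 - s ^+ 2) = r ^+ 2.
  apply: (@mulfI _ (l - 1)); first by rewrite subr_eq0.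
  by move: kE; rewrite s'2 xE yE !exprMn; lra.
(* Normals and gaps are proportional with the same ratio, so the left-hand side of the identity
   vanishes. Hence the third gap vanishes, which together with [dE] forces [r = 0]. *)
have := lor3_gap b b' r x y s x' y' s'; rewrite /= nE gE.
set g := gap b _ _ _; set n := nvec r x y s.
rewrite [X in X = _ -> _](_ : _ = 0); last by rewrite /lor3 /lin3 /=; ring.
move=> /esym/eqP; rewrite mulf_eq0 sqrf_eq0 mulf_eq0 pnatr_eq0 (negbTE r1) /=.
rewrite oppr_eq0 !mulf_eq0 (negbTE l0) (negbTE g0) /=.
have -> : gap (b (+) b') s s' ((x - x') ^+ 2 + (y - y') ^+ 2) =
    (1 - l) ^+ 2 * (s ^+ 2 - (x ^+ 2 + y ^+ 2)).
  have -> : gap (b (+) b') s s' ((x - x') ^+ 2 + (y - y') ^+ 2) =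
      s ^+ 2 - 2 * (sg b * s) * (sg b' * s') + s' ^+ 2
       - ((x - x') ^+ 2 + (y - y') ^+ 2).
    by rewrite /gap /sg; case: (b); case: (b') => /=; ring.
  rewrite sE s'2 xE yE; transitivity (s ^+ 2 - 2 * l * (sg b ^+ 2 * s ^+ 2) +
    l ^+ 2 * s ^+ 2 - ((x - l * x) ^+ 2 + (y - l * y) ^+ 2)); first by ring.
  by rewrite sg2; ring.
rewrite mulf_eq0 sqrf_eq0 subr_eq0 eq_sym (negbTE l1) /= => /eqP e.
have : r ^+ 2 = 0 by rewrite -dE; move: e; nra.
by move/eqP; rewrite sqrf_eq0 (negbTE r1).
Qed.

Definition contact (R : realType) (b b' : bool) (r x y s x' y' s' : R) :
    set (R * R * R) :=
  light_on (nvec r x y s) (nvec r x' y' s')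
    (gap b r s (x ^+ 2 + y ^+ 2)) (gap b' r s' (x' ^+ 2 + y' ^+ 2)).

Definition gap3 (R : realType) (b b' : bool) (r x y s x' y' s' : R) : R :=
  gap b r s (x ^+ 2 + y ^+ 2) * gap b' r s' (x' ^+ 2 + y' ^+ 2) *
    gap (b (+) b') s s' ((x - x') ^+ 2 + (y - y') ^+ 2).

Lemma nvec_neq0 (R : realType) (r x y s : R) :
  0 < r -> 0 < s -> (x, y, s) <> (0, 0, r) -> nvec r x y s <> 0.
Proof.
move=> r0 s0 neq [] e1 e2 e3; apply: neq.
have r2 : 2 * r != 0 by rewrite mulf_neq0 ?pnatr_eq0 // lt0r_neq0.
have x0 : x = 0 by apply: (mulfI r2); rewrite e2 mulr0.
have y0 : y = 0 by apply: (mulfI r2); rewrite e3 mulr0.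
move: e1; rewrite x0 y0 !expr0n /= addr0 sub0r => /eqP.
rewrite addrC subr_eq0 eqf_sqr => /orP[/eqP e|/eqP e]; last by exfalso; lra.
by rewrite e.
Qed.

Lemma contact_coaxial (R : realType) (b b' : bool) (r x y s x' y' s' : R) :
  0 < r -> 0 < s -> 0 < s' -> (x, y, s) <> (0, 0, r) ->
  (x', y', s') <> (0, 0, r) -> (x, y, s) <> (x', y', s') ->
  cross3 (nvec r x y s) (nvec r x' y' s') = 0 ->
  lor3 (nvec r x y s) (nvec r x y s) != 0 ->
  enumerates [::] (contact b b' r x y s x' y' s').
Proof.
move=> r0 s0 s0' neq1 neq2 neq w0 N0; apply: enumerates_nil => v [_ vn vm].
have [l lE] := parallel3 (nvec_neq0 r0 s0 neq1) w0.
have := coaxial_inconsistent b b' r0 s0 s0' neq2 neq N0 lE.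
by rewrite -vn -vm lE => /negP; apply; apply/eqP; rewrite /dot3 /lin3 /=; ring.
Qed.

(** A lightlike direction would give a double point, and so would a common normal of coaxial circles
    that is not timelike. In the timelike coaxial case the contact set is empty, and [gap3] is
    positive, so the formula counts zero as well. *)
Lemma contact_no_common (R : realType) (b b' : bool) (r x y s x' y' s' : R) :
  0 < r -> 0 < s -> 0 < s' -> (x, y, s) <> (0, 0, r) ->
  (x', y', s') <> (0, 0, r) -> (x, y, s) <> (x', y', s') ->
  ~ (exists X Y, common3 r x y s x' y' s' X Y) ->
  exists S, enumerates S (contact b b' r x y s x' y' s') /\
    size S = nroots (- gap3 b b' r x y s x' y' s').
Proof.
move=> r0 s0 s0' neq1 neq2 neq noc.
have r2 : 0 < (2 * r) ^+ 2 by rewrite exprn_gt0 // mulr_gt0.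
set n := nvec r x y s; set m := nvec r x' y' s'.
have [w0|w0] := pselect (cross3 n m = 0); last first.
  have [nw mw] := dot3_cross3 n m.
  have ww : lor3 (cross3 n m) (cross3 n m) != 0.
    by apply/eqP => ww; apply: noc; apply: light_common3 ww nw mw.
  have [S [SE sS]] := light_on_count (gap b r s (x ^+ 2 + y ^+ 2))
    (gap b' r s' (x' ^+ 2 + y' ^+ 2)) ww.
  by exists S; split=> //; rewrite sS lor3_gap nroots_pM.
have n0 := nvec_neq0 r0 s0 neq1.
have [l lE] := parallel3 n0 w0.
have N0 : lor3 n n < 0.
  rewrite ltNge; apply/negP => nn; apply: noc.
  have [v [v0 vv nv]] := spacelike_orth_light n0 nn.
  apply: (light_common3 r0 v0 vv nv); rewrite -/m lE.
  transitivity (l * dot3 n v); last by rewrite nv mulr0.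
  by rewrite /dot3 /lin3 /=; ring.
exists [::]; split; first by apply: contact_coaxial => //; rewrite lt_eqF.
have := coaxial_inconsistent b b' r0 s0 s0' neq2 neq (ltr0_neq0 N0) lE.
have := lor3_gap b b' r x y s x' y' s'; rewrite /= -/n -/m lE -/(gap3 _ _ _ _ _ _ _ _ _).
set g := gap b _ _ _; set h := gap b' _ _ _; set D := gap3 _ _ _ _ _ _ _ _ _.
move=> DE hg; rewrite /= -(nroots_pM _ r2) -DE.
have hg2 : 0 < (g * l - h) ^+ 2.
  by rewrite lt_neqAle sqr_ge0 andbT eq_sym sqrf_eq0 subr_eq0 eq_sym mulrC.
rewrite [X in nroots X](_ : _ = (g * l - h) ^+ 2 * lor3 n n); last first.
  by rewrite /lor3 /lin3 /=; ring.
by rewrite nroots_pM // /nroots leNgt N0 ltNge (ltW N0).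
Qed.

Lemma light_cross (R : realType) (n m v : R * R * R) :
  dot3 n v = 0 -> dot3 m v = 0 -> cross3 v (cross3 n m) = 0.
Proof.
move=> nv mv; apply: triple_eq; rewrite /=.
- transitivity (n.1.1 * dot3 m v - m.1.1 * dot3 n v);
    [by rewrite /dot3; ring|by rewrite nv mv !mulr0 subr0].
- transitivity (n.1.2 * dot3 m v - m.1.2 * dot3 n v);
    [by rewrite /dot3; ring|by rewrite nv mv !mulr0 subr0].
- transitivity (n.2 * dot3 m v - m.2 * dot3 n v);
    [by rewrite /dot3; ring|by rewrite nv mv !mulr0 subr0].
Qed.

Lemma light_proportional (R : realType) (n m v : R * R * R) :
  v <> 0 -> dot3 n v = 0 -> dot3 m v = 0 -> lor3 v v = 0 ->
  lor3 (cross3 n m) (cross3 n m) = 0.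
Proof.
move=> v0 nv mv vv; have [l ->] := parallel3 v0 (light_cross nv mv).
transitivity (l ^+ 2 * lor3 v v); first by rewrite /lor3 /lin3 /=; ring.
by rewrite vv mulr0.
Qed.

Lemma contact_one_common (R : realType) (b b' : bool)
    (r x y s x' y' s' X Y : R) :
  0 < r -> common3 r x y s x' y' s' X Y ->
  cross3 (nvec r x y s) (nvec r x' y' s') <> 0 ->
  (gap b r s (x ^+ 2 + y ^+ 2), gap b' r s' (x' ^+ 2 + y' ^+ 2)) <> (0, 0) ->
  exists S, enumerates S (contact b b' r x y s x' y' s') /\
    size S = (gap3 b b' r x y s x' y' s' != 0) :> nat.
Proof.
move=> r0 [XY XY1 XY2] w0 g0.
have v0 : (- r, X, Y) <> 0 by case=> e _ _; move: r0; lra.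
have vv : lor3 (- r, X, Y) (- r, X, Y) = 0.
  by rewrite /lor3 /= -!expr2 XY; ring.
have nv := (light_point x y s r0 XY).1 XY1.
have mv := (light_point x' y' s' r0 XY).1 XY2.
have ww := light_proportional v0 nv mv vv.
have [S [SE sS]] := light_on_count1 w0 ww g0.
exists S; split=> //; rewrite sS lor3_gap mulf_eq0 sqrf_eq0 mulf_eq0.
by rewrite pnatr_eq0 (gt_eqF r0) /= oppr_eq0.
Qed.

(** With both gaps zero the planes contain the whole generator of the common point, that is, circles
    tangent to one another there. Its natural multiples already form an infinite set. *)
Lemma contact_infinite (R : realType) (b b' : bool)
    (r x y s x' y' s' X Y : R) :
  0 < r -> common3 r x y s x' y' s' X Y ->
  gap b r s (x ^+ 2 + y ^+ 2) = 0 -> gap b' r s' (x' ^+ 2 + y' ^+ 2) = 0 ->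
  infinite_set (contact b b' r x y s x' y' s').
Proof.
move=> r0 [XY XY1 XY2] g0 h0.
have nv := (light_point x y s r0 XY).1 XY1.
have mv := (light_point x' y' s' r0 XY).1 XY2.
have v0 : (- r, X, Y) <> 0 by case=> e _ _; move: r0; lra.
apply/infiniteP; pose f (k : nat) := lin3 1 0 k%:R (- r, X, Y).
have f_inj : injective f by move=> i j /(lin3_inj v0)/eqP; rewrite eqr_nat => /eqP.
apply: (@card_le_trans _ _ _ (range f)).
  have := @inj_card_eq _ _ [set: nat] f (in2W f_inj).
  by rewrite card_eq_le => /andP[].
apply: subset_card_le => _ [k _ <-]; rewrite /contact g0 h0; split.
- transitivity (k%:R ^+ 2 * (X ^+ 2 + Y ^+ 2 - r ^+ 2)).
    by rewrite /lor3 /f /lin3 /=; ring.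
  by rewrite XY subrr mulr0.
- transitivity (k%:R * dot3 (nvec r x y s) (- r, X, Y)).
    by rewrite /dot3 /f /lin3 /=; ring.
  by rewrite nv mulr0.
- transitivity (k%:R * dot3 (nvec r x' y' s') (- r, X, Y)).
    by rewrite /dot3 /f /lin3 /=; ring.
  by rewrite mv mulr0.
Qed.

(** * Circles and their intersections *)

Definition circ (R : realType) (c : R * R) (r : R) : set (R * R) :=
  [set p | Defs.edist p c = r].

Definition sqd (R : realType) (p q : R * R) : R :=
  (p.1 - q.1) ^+ 2 + (p.2 - q.2) ^+ 2.

Lemma sqd_ge0 (R : realType) (p q : R * R) : 0 <= sqd p q.
Proof. by rewrite addr_ge0 ?sqr_ge0. Qed.

Lemma sqdC (R : realType) (p q : R * R) : sqd p q = sqd q p.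
Proof. by rewrite /sqd; ring. Qed.

Lemma sqd_eq0 (R : realType) (p q : R * R) : sqd p q = 0 -> p = q.
Proof.
move=> /eqP; rewrite paddr_eq0 ?sqr_ge0 // !sqrf_eq0 !subr_eq0.
by case: p q => [? ?] [? ?] /= /andP[/eqP -> /eqP ->].
Qed.

Lemma circP (R : realType) (c : R * R) (r : R) (p : R * R) :
  0 <= r -> circ c r p <-> sqd p c = r ^+ 2.
Proof.
move=> r0; rewrite /circ /Defs.edist /=; split=> [<-|].
  by rewrite sqr_sqrtr // sqd_ge0.
by rewrite /sqd => ->; rewrite sqrtr_sqr ger0_norm.
Qed.

Lemma circ_inj (R : realType) (c c' : R * R) (r r' : R) :
  0 < r -> 0 < r' -> circ c r = circ c' r' -> c = c' /\ r = r'.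
Proof.
move=> r0 r0' E.
have on t : sqd (c.1 + t.1, c.2 + t.2) c = r ^+ 2 ->
    sqd (c.1 + t.1, c.2 + t.2) c' = r' ^+ 2.
  by move=> /(circP _ _ (ltW r0)); rewrite E => /(circP _ _ (ltW r0')).
have e1 : sqd (c.1 + r, c.2 + 0) c' = r' ^+ 2.
  by apply: (on (r, 0)); rewrite /sqd /=; ring.
have e2 : sqd (c.1 + - r, c.2 + 0) c' = r' ^+ 2.
  by apply: (on (- r, 0)); rewrite /sqd /=; ring.
have e3 : sqd (c.1 + 0, c.2 + r) c' = r' ^+ 2.
  by apply: (on (0, r)); rewrite /sqd /=; ring.
have e4 : sqd (c.1 + 0, c.2 + - r) c' = r' ^+ 2.
  by apply: (on (0, - r)); rewrite /sqd /=; ring.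
have r4 : 4 * r != 0 by rewrite mulf_neq0 ?pnatr_eq0 // lt0r_neq0.
have h1 : c.1 = c'.1.
  by apply: (mulfI r4); move: e1 e2; rewrite /sqd /=; lra.
have h2 : c.2 = c'.2.
  by apply: (mulfI r4); move: e3 e4; rewrite /sqd /=; lra.
split; first by case: c c' h1 h2 {E on e1 e2 e3 e4} => [? ?] [? ?] /= -> ->.
move: e1; rewrite /sqd /= h1 h2 => e1.
have /eqP : r ^+ 2 = r' ^+ 2 by rewrite -e1; ring.
by rewrite eqrXn2 // ?ltW // => /eqP.
Qed.

Lemma circle_line_meet (R : realType) (c : R * R) (r a b k : R) :
  0 < r -> a ^+ 2 + b ^+ 2 != 0 ->
  exists s, enumerates s
     [set p | circ c r p /\ a * (p.1 - c.1) + b * (p.2 - c.2) = k] /\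
    size s = nroots ((a ^+ 2 + b ^+ 2) * r ^+ 2 - k ^+ 2).
Proof.
move=> r0 m0; set m := a ^+ 2 + b ^+ 2 in m0 *.
have [s [sE ss]] :=
  quadratic_roots 0 (k ^+ 2 - m * r ^+ 2) (oner_neq0 R).
(* In the orthogonal frame [(a, b)], [(b, - a)] the line fixes the first coordinate [k]; the circle
   becomes a pure quadratic in the second one, [z]. *)
pose f (z : R) := (c.1 + (a * k + b * z) / m, c.2 + (b * k - a * z) / m).
exists (map f s); split; last first.
  by rewrite size_map ss expr0n /= mul1r sub0r opprB.
apply: (enumerates_map _ sE) => [z z' _ _ []|].
  move=> /addrI/(mulIf (invr_neq0 m0))/addrI/eqP; rewrite -subr_eq0 -mulrBr.
  rewrite mulf_eq0 subr_eq0 => /orP[/eqP b0|/eqP //].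
  move=> /addrI/(mulIf (invr_neq0 m0))/addrI/oppr_inj/eqP.
  rewrite -subr_eq0 -mulrBr mulf_eq0 subr_eq0 => /orP[/eqP a0|/eqP //].
  by move: m0; rewrite /m a0 b0 expr0n addr0 eqxx.
move=> p /=; rewrite (circP _ _ (ltW r0)); split.
  move=> [pc pk]; exists (b * (p.1 - c.1) - a * (p.2 - c.2)).
    rewrite -pk -pc /sqd /m; ring.
  by rewrite /f -pk /m; case: p {pc pk} => p q /=; congr pair; field.
move=> [z zE ->]; rewrite /f /=; split; last by rewrite /m; field.
transitivity ((k ^+ 2 + z ^+ 2) / m); first by rewrite /sqd /= /m; field.
by apply: (mulIf m0); rewrite divfK //; move: zE; lra.
Qed.

Definition gapc (R : realType) (b : bool) (c : R * R) (r : R) (c' : R * R)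
  (s : R) : R := gap b r s (sqd c c').

(** Outside the concentric case the second circle may be replaced by the radical axis, and the
    discriminant of circle and axis factors into the two gaps. *)
Lemma circle_circle_meet (R : realType) (c c' : R * R) (r s : R) :
  0 < r -> 0 < s -> (c, r) <> (c', s) ->
  exists S, enumerates S (circ c r `&` circ c' s) /\
    size S = nroots (- (gapc false c r c' s * gapc true c r c' s)).
Proof.
move=> r0 s0 neq.
have [d0|d0] := eqVneq (sqd c c') 0.
  exists [::]; have E := sqd_eq0 d0; split.
    apply: enumerates_nil => p [/(circP _ _ (ltW r0)) pr].
    move=> /(circP _ _ (ltW s0)); rewrite -E pr => /eqP.
    by rewrite eqrXn2 ?ltW // => /eqP rs; apply: neq; rewrite rs E.
  rewrite /gapc d0 /gap !subr0 -exprMn /nroots oppr_ge0 oppr_gt0.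
  have h : 0 < ((r - s) * (r + s)) ^+ 2.
    rewrite lt_neqAle sqr_ge0 andbT eq_sym sqrf_eq0 mulf_eq0 negb_or.
    rewrite subr_eq0 (gt_eqF (addr_gt0 r0 s0)) andbT; apply/eqP => rs.
    by apply: neq; rewrite rs E.
  by rewrite leNgt h ltNge (ltW h).
have m0 : (2 * (c'.1 - c.1)) ^+ 2 + (2 * (c'.2 - c.2)) ^+ 2 != 0.
  rewrite !exprMn -mulrDr mulf_neq0 ?sqrf_eq0 ?pnatr_eq0 //.
  by move: d0; rewrite sqdC.
have [S [SE sS]] :=
  circle_line_meet c (sqd c c' + r ^+ 2 - s ^+ 2) r0 m0.
exists S; split; last first.
  by rewrite sS; congr nroots; rewrite /gapc /gap /sqd; ring.
case: SE => uS SE; split=> // p; rewrite -SE /= /setI /=.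
rewrite (circP _ _ (ltW r0)) (circP _ _ (ltW s0)).
by split=> -[h1 h2]; split=> //; move: h1 h2; rewrite /sqd; lra.
Qed.

Lemma nroots_eq1 (R : realType) (D : R) : nroots D = 1%N <-> D = 0.
Proof. by rewrite /nroots; case: ltgtP => // D0; split=> // e; rewrite e ltxx in D0. Qed.

Lemma meet_once_circ (R : realType) (c c' : R * R) (r s : R) :
  0 < r -> 0 < s -> (c, r) <> (c', s) ->
  meet_once (circ c r) (circ c' s) <->
  gapc false c r c' s = 0 \/ gapc true c r c' s = 0.
Proof.
move=> r0 s0 neq; have [S [SE sS]] := circle_circle_meet r0 s0 neq.
rewrite /meet_once (enumerates_exists1 SE) sS nroots_eq1.
split=> [/eqP|[->|->]]; rewrite ?mul0r ?mulr0 ?oppr0 //.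
by rewrite oppr_eq0 mulf_eq0 => /orP[/eqP|/eqP]; [left|right].
Qed.

Lemma tangent_circ (R : realType) (c c' : R * R) (r s : R) :
  0 < r -> 0 < s ->
  (circ c r = circ c' s \/ meet_once (circ c r) (circ c' s)) <->
  gapc false c r c' s = 0 \/ gapc true c r c' s = 0.
Proof.
move=> r0 s0; have [[-> ->]|neq] := pselect ((c, r) = (c', s)).
  by split=> _; left=> //; rewrite /gapc /gap /sqd !subrr expr0n /=; ring.
rewrite -meet_once_circ //; split; last by right.
by case=> // /(circ_inj r0 s0)[e1 e2]; exfalso; apply: neq; rewrite e1 e2.
Qed.

(** * Circles and lines as lightlike vectors *)

(* For lightlike [v = (u, a, b)] this is the circle of radius [r / |u + 1|]
   and center [o - r / (u + 1) (a, b)], or a line when [u = -1]. *)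
Definition obj (R : realType) (o : R * R) (r : R) (v : R * R * R) :
    set (R * R) :=
  [set p | (v.1.1 + 1) * sqd p o +
    2 * r * (v.1.2 * (p.1 - o.1) + v.2 * (p.2 - o.2)) +
    r ^+ 2 * (v.1.1 - 1) = 0].

Definition obj_center (R : realType) (o : R * R) (r : R) (v : R * R * R) :
    R * R :=
  (o.1 - r / (v.1.1 + 1) * v.1.2, o.2 - r / (v.1.1 + 1) * v.2).

Lemma obj_circ (R : realType) (o : R * R) (r : R) (v : R * R * R) :
  lor3 v v = 0 -> v.1.1 + 1 != 0 ->
  obj o r v = circ (obj_center o r v) `|r / (v.1.1 + 1)|.
Proof.
move=> vv u1; apply/seteqP.
have E p : obj o r v p <-> circ (obj_center o r v) `|r / (v.1.1 + 1)| p.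
  rewrite circP // real_normK ?num_real // /obj /=.
  have e : v.1.2 ^+ 2 + v.2 ^+ 2 = v.1.1 ^+ 2 by move: vv; rewrite /lor3; lra.
  have -> : sqd p (obj_center o r v) = sqd p o + 2 * (r / (v.1.1 + 1)) *
      (v.1.2 * (p.1 - o.1) + v.2 * (p.2 - o.2)) +
      (r / (v.1.1 + 1)) ^+ 2 * v.1.1 ^+ 2.
    by rewrite -e /sqd /obj_center /=; ring.
  set s := sqd p o; set z := v.1.2 * _ + v.2 * _; split=> h.
    apply/eqP; rewrite -subr_eq0; apply/eqP; apply: (mulfI u1).
    by rewrite mulr0 -[RHS]h; field.
  have -> : s = (r / (v.1.1 + 1)) ^+ 2 - 2 * (r / (v.1.1 + 1)) * z -
      (r / (v.1.1 + 1)) ^+ 2 * v.1.1 ^+ 2 by move: h; lra.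
  by field.
by split=> p /E.
Qed.

Lemma obj_line (R : realType) (o : R * R) (r : R) (v : R * R * R) :
  0 < r -> v.1.1 + 1 = 0 ->
  obj o r v = [set p | v.1.2 * (p.1 - o.1) + v.2 * (p.2 - o.2) = r].
Proof.
move=> r0 u1; have r2 : 2 * r != 0 by rewrite mulf_neq0 ?pnatr_eq0 ?lt0r_neq0.
have u : v.1.1 = -1 by move: u1; lra.
apply/seteqP; rewrite /obj; split=> p /=; rewrite u1 mul0r add0r u => h.
  by apply: (mulfI r2); move: h; lra.
by rewrite h; ring.
Qed.

Lemma obj_lineP (R : realType) (o : R * R) (r : R) (v : R * R * R) :
  0 < r -> lor3 v v = 0 -> v.1.1 + 1 = 0 -> is_line (obj o r v).
Proof.
move=> r0 vv u1; exists v.1.2, v.2, (r + v.1.2 * o.1 + v.2 * o.2); split.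
  case=> e1 e2; move: vv; rewrite /lor3 e1 e2; have -> : v.1.1 = -1 by lra.
  by rewrite !mul0r !add0r mulrNN mulr1 => /eqP; rewrite oppr_eq0 oner_eq0.
rewrite obj_line //; apply/seteqP; split=> p /=; lra.
Qed.

Lemma is_circle_circ (R : realType) (c : R * R) (r : R) :
  0 < r -> is_circle (circ c r).
Proof. by move=> r0; exists c, r. Qed.

Lemma circ_not_set1 (R : realType) (c : R * R) (r : R) (p : R * R) :
  0 < r -> circ c r <> [set p].
Proof.
move=> r0 E.
have e1 : circ c r (c.1 + r, c.2) by apply/(circP _ _ (ltW r0)); rewrite /sqd /=; ring.
have e2 : circ c r (c.1 - r, c.2) by apply/(circP _ _ (ltW r0)); rewrite /sqd /=; ring.
by move: e1 e2; rewrite E /= => <- [] h; move: r0; lra.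
Qed.

Lemma circ_not_line (R : realType) (c : R * R) (r : R) :
  0 < r -> ~ is_line (circ c r).
Proof.
move=> r0 [a [b [k [ab0 E]]]]; apply: ab0.
have on t : sqd (c.1 + t.1, c.2 + t.2) c = r ^+ 2 ->
    a * (c.1 + t.1) + b * (c.2 + t.2) = k.
  by move=> /(circP _ _ (ltW r0)); rewrite E.
have e1 : a * (c.1 + r) + b * (c.2 + 0) = k.
  by apply: (on (r, 0)); rewrite /sqd /=; ring.
have e2 : a * (c.1 - r) + b * (c.2 + 0) = k.
  by apply: (on (- r, 0)); rewrite /sqd /=; ring.
have e3 : a * (c.1 + 0) + b * (c.2 + r) = k.
  by apply: (on (0, r)); rewrite /sqd /=; ring.
have e4 : a * (c.1 + 0) + b * (c.2 - r) = k.
  by apply: (on (0, - r)); rewrite /sqd /=; ring.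
have r1 := lt0r_neq0 r0.
congr pair; apply: (mulIf r1); rewrite mul0r; lra.
Qed.

Lemma line_not_set1 (R : realType) (L : set (R * R)) (p : R * R) :
  is_line L -> L <> [set p].
Proof.
move=> [a [b [k [ab0 ->]]]] E; apply: ab0.
have pk : a * p.1 + b * p.2 = k by have : [set p] p by []; rewrite -E.
have : [set p] (p.1 + b, p.2 - a) by rewrite -E /= -pk; ring.
rewrite /=; case: p {E pk} => x y /= [e1 e2].
by congr pair; lra.
Qed.

Lemma obj_kind (R : realType) (o : R * R) (r : R) (v : R * R * R) :
  0 < r -> lor3 v v = 0 ->
  (exists c s, [/\ 0 < s, obj o r v = circ c s & v.1.1 + 1 != 0]) \/
  (is_line (obj o r v) /\ v.1.1 + 1 = 0).
Proof.
move=> r0 vv; have [u|u] := eqVneq (v.1.1 + 1) 0.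
  by right; split=> //; exact: obj_lineP.
left; exists (obj_center o r v), `|r / (v.1.1 + 1)|; split=> //.
  by rewrite normr_gt0 mulf_neq0 ?invr_neq0 // lt0r_neq0.
exact: obj_circ.
Qed.

Lemma obj_not_set1 (R : realType) (o : R * R) (r : R) (v : R * R * R)
  (p : R * R) : 0 < r -> lor3 v v = 0 -> obj o r v <> [set p].
Proof.
move=> r0 vv; have [[c [s [s0 -> _]]]|[L _]] := obj_kind o r0 vv.
  exact: circ_not_set1.
exact: line_not_set1.
Qed.

(** Only one orientation of a circle agrees with the base circle: reversal replaces [|r - q|] by
    [|r + q|], and these differ for nonzero [q]. This makes counting vectors the same as counting
    unoriented objects. *)
Lemma obj_inj (R : realType) (o : R * R) (r : R) (v w : R * R * R) :
  0 < r -> lor3 v v = 0 -> lor3 w w = 0 -> obj o r v = obj o r w -> v = w.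
Proof.
move=> r0 vv ww E; have r1 := lt0r_neq0 r0.
have [[c [s [s0 cE u]]]|[L u]] := obj_kind o r0 vv; last first.
  have [[c [s [s0 cE _]]]|[_ u']] := obj_kind o r0 ww.
    by exfalso; apply: (@circ_not_line _ c _ s0); rewrite -cE -E.
  have v1 : v.1.1 = -1 by move: u; lra.
  have w1 : w.1.1 = -1 by move: u'; lra.
  have vv' : v.1.2 ^+ 2 + v.2 ^+ 2 = 1 by move: vv; rewrite /lor3 v1; lra.
  have ww' : w.1.2 ^+ 2 + w.2 ^+ 2 = 1 by move: ww; rewrite /lor3 w1; lra.
  (* The contact point of the first line with the base circle. That it lies on the second line makes
     the product of the two unit normals equal to 1, so they coincide. *)
  have : obj o r v (o.1 + r * v.1.2, o.2 + r * v.2).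
    rewrite obj_line //=; transitivity (r * (v.1.2 ^+ 2 + v.2 ^+ 2)).
      by ring.
    by rewrite vv' mulr1.
  rewrite E obj_line //= => e.
  have vw : w.1.2 * v.1.2 + w.2 * v.2 = 1.
    by apply: (mulfI r1); rewrite mulr1 -[RHS]e; ring.
  have : (w.1.2 - v.1.2) ^+ 2 + (w.2 - v.2) ^+ 2 == 0.
    by apply/eqP; move: vv' ww' vw; lra.
  rewrite paddr_eq0 ?sqr_ge0 // !sqrf_eq0 !subr_eq0 => /andP[/eqP a /eqP b].
  by apply: triple_eq; rewrite ?v1 ?w1.
have [[c' [s' [s0' cE' u']]]|[L u']] := obj_kind o r0 ww; last first.
  by exfalso; apply: (@circ_not_line _ c _ s0); rewrite -cE E.
move: E; rewrite !obj_circ // => /circ_inj[]; rewrite ?normr_gt0 ?mulf_neq0 ?invr_neq0 //.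
rewrite /obj_center => -[/addrI/oppr_inj e1 /addrI/oppr_inj e2] /eqP.
rewrite eqr_norm2 => /orP[/eqP e3|/eqP e3].
  have e4 : v.1.1 = w.1.1.
    by have /invr_inj/addIr := mulfI r1 e3.
  have q0 : r / (v.1.1 + 1) != 0 by rewrite mulf_neq0 ?invr_neq0.
  by apply: triple_eq => //; apply: (mulfI q0); rewrite ?e1 ?e2 e3.
exfalso.
have e4 : v.1.1 + 1 = - (w.1.1 + 1).
  by apply/invr_inj; rewrite invrN; apply: (mulfI r1); rewrite mulrN.
have q0 : r / (w.1.1 + 1) != 0 by rewrite mulf_neq0 ?invr_neq0.
have a : v.1.2 = - w.1.2.
  by apply: (mulfI q0); rewrite mulrN -e1 e3; ring.
have b : v.2 = - w.2.
  by apply: (mulfI q0); rewrite mulrN -e2 e3; ring.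
have : v.1.1 ^+ 2 = w.1.1 ^+ 2.
  by move: vv ww; rewrite /lor3 a b; lra.
have -> : v.1.1 = - (w.1.1 + 2) by move: e4; lra.
by move=> e5; move/negP: u'; apply; apply/eqP; move: e5; lra.
Qed.

Definition relvec (R : realType) (o : R * R) (r : R) (c : R * R) (s : R) :
    R * R * R :=
  nvec r (c.1 - o.1) (c.2 - o.2) s.

(** Changing the sign of the first radius exchanges the two gaps, so the signed radius [q] can be
    used throughout. *)
Lemma gap_norm (R : realType) (r s d : R) :
  gap false `|r| s d = 0 \/ gap true `|r| s d = 0 <->
  gap false r s d * gap true r s d = 0.
Proof.
have -> : gap false r s d * gap true r s d =
    gap false `|r| s d * gap true `|r| s d.
  by rewrite /gap; case: (ger0P r) => // _; ring.
split=> [[->|->]|/eqP]; rewrite ?mul0r ?mulr0 //.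
by rewrite mulf_eq0 => /orP[/eqP|/eqP]; [left|right].
Qed.

Lemma obj_tangent (R : realType) (o c : R * R) (r s : R) (v : R * R * R) :
  0 < r -> 0 < s -> lor3 v v = 0 ->
  (obj o r v = circ c s \/ meet_once (obj o r v) (circ c s)) <->
  exists b, dot3 (relvec o r c s) v = gapc b o r c s.
Proof.
move=> r0 s0 vv; have r1 := lt0r_neq0 r0.
set n := relvec o r c s.
have bE : (exists b, dot3 n v = gapc b o r c s) <->
    (gapc false o r c s - dot3 n v) * (gapc true o r c s - dot3 n v) = 0.
  split=> [[[] ->]|/eqP]; rewrite ?subrr ?mul0r ?mulr0 //.
  by rewrite mulf_eq0 !subr_eq0 => /orP[/eqP <-|/eqP <-]; [exists false|exists true].
have e : v.1.2 ^+ 2 + v.2 ^+ 2 = v.1.1 ^+ 2 by move: vv; rewrite /lor3; lra.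
rewrite bE; have [u|u] := eqVneq (v.1.1 + 1) 0.
  have v1 : v.1.1 = -1 by move: u; lra.
  have m1 : v.1.2 ^+ 2 + v.2 ^+ 2 = 1 by rewrite e v1; ring.
  have m0 : v.1.2 ^+ 2 + v.2 ^+ 2 != 0 by rewrite m1 oner_neq0.
  pose k := r - v.1.2 * (c.1 - o.1) - v.2 * (c.2 - o.2).
  have [S [SE sS]] := circle_line_meet c k s0 m0.
  have SE' : enumerates S (obj o r v `&` circ c s).
    case: SE => uS SE; split=> // p; rewrite -SE obj_line //= /setI /k /=.
    by split=> -[h1 h2]; split=> //; move: h1 h2; lra.
  (* For a line the two plane equations say that the center [c] is at signed distance [s] or [- s]
     from it, so their product is the discriminant up to a nonzero factor. *)
  have -> : (gapc false o r c s - dot3 n v) * (gapc true o r c s - dot3 n v) =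
      (2 * r) ^+ 2 * - (s ^+ 2 - k ^+ 2).
    rewrite /k /gapc /gap /n /relvec /dot3 /nvec /sqd /= v1; ring.
  rewrite /meet_once (enumerates_exists1 SE') sS nroots_eq1 m1 mul1r; split.
    case=> [E|->]; last by rewrite oppr0 mulr0.
    by exfalso; apply: (@circ_not_line _ c _ s0); rewrite -E; exact: obj_lineP.
  move=> /eqP; rewrite mulf_eq0 sqrf_eq0 mulf_eq0 pnatr_eq0 (negbTE r1) /=.
  by rewrite oppr_eq0 => /eqP; right.
have q0 : 0 < `|r / (v.1.1 + 1)|.
  by rewrite normr_gt0 mulf_neq0 ?invr_neq0.
rewrite (obj_circ _ _ vv u) tangent_circ // /gapc gap_norm.
pose q := r / (v.1.1 + 1); have qE : q * (v.1.1 + 1) = r by rewrite divfK.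
rewrite -/q; set d := sqd (obj_center o r v) c.
have dE : d = sqd o c + 2 * q * (v.1.2 * (c.1 - o.1) + v.2 * (c.2 - o.2)) +
    q ^+ 2 * v.1.1 ^+ 2.
  by rewrite -e /d /sqd /obj_center -/q /=; ring.
(* The factor [u + 1] turns the quadratic gap of the signed circle into the affine equation of the
   plane. *)
have E b : (v.1.1 + 1) * gap b q s d = gap b r s (sqd o c) - dot3 n v.
  have -> : sqd o c = (c.1 - o.1) ^+ 2 + (c.2 - o.2) ^+ 2.
    by rewrite sqdC.
  have dE' : d = (c.1 - o.1) ^+ 2 + (c.2 - o.2) ^+ 2 +
      2 * q * (v.1.2 * (c.1 - o.1) + v.2 * (c.2 - o.2)) + q ^+ 2 * v.1.1 ^+ 2.
    by rewrite dE sqdC.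
  rewrite dE' /gap /n /relvec /dot3 /nvec /= -qE.
  by case: b; ring.
rewrite -!E; split=> [h|/eqP].
  transitivity ((v.1.1 + 1) ^+ 2 * (gap false q s d * gap true q s d)).
    ring.
  by rewrite h mulr0.
rewrite !mulf_eq0 (negbTE u) /= => /orP[/eqP ->|/eqP ->]; by rewrite ?mul0r ?mulr0.
Qed.

Lemma circle_objP (R : realType) (o c : R * R) (r s : R) :
  0 < r -> 0 < s -> (exists b, gapc b c s o r = 0) ->
  exists2 v, lor3 v v = 0 & circ c s = obj o r v.
Proof.
move=> r0 s0 [b gE]; have s1 := lt0r_neq0 s0; have r1 := lt0r_neq0 r0.
(* External contact is internal contact with reversed orientation. The witness [v] solves [q = e s]
   and [o - q (a, b) = c]. *)
pose e : R := if b then -1 else 1.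
have e2 : e ^+ 2 = 1 by rewrite /e; case: (b); ring.
have e0 : e != 0 by rewrite -sqrf_eq0 e2 oner_neq0.
have en : `|e| = 1 by rewrite /e; case: (b); rewrite ?normrN normr1.
pose v : R * R * R := (e * r / s - 1, - (e * (c.1 - o.1)) / s,
  - (e * (c.2 - o.2)) / s).
have vu : v.1.1 + 1 = e * r / s by rewrite /v /= subrK.
have vv : lor3 v v = 0.
  transitivity (- gapc b c s o r / s ^+ 2); last by rewrite gE oppr0 mul0r.
  by rewrite /lor3 /v /gapc /gap /sqd /e; case: (b) => /=; field.
exists v => //; have er : e * r != 0 by rewrite mulf_neq0.
have u : v.1.1 + 1 != 0 by rewrite vu mulf_neq0 ?invr_neq0.
have ru : r / (v.1.1 + 1) = s / e by rewrite vu; field; rewrite ?e0 ?r1 ?s1.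
rewrite obj_circ // ru normrM normfV en invr1 mulr1 gtr0_norm //.
congr circ; rewrite /obj_center ru /v /=.
by case: (c) => x y /=; congr pair; field; rewrite ?e0 ?s1.
Qed.

Lemma line_objP (R : realType) (o : R * R) (L : set (R * R)) (r : R) :
  0 < r -> is_line L -> meet_once L (circ o r) ->
  exists2 v, lor3 v v = 0 & L = obj o r v.
Proof.
move=> r0 [a [b [k [ab0 ->]]]]; have r1 := lt0r_neq0 r0.
have m0 : a ^+ 2 + b ^+ 2 != 0.
  apply/eqP => /eqP; rewrite paddr_eq0 ?sqr_ge0 // !sqrf_eq0.
  by move=> /andP[/eqP a0 /eqP b0]; apply: ab0; rewrite a0 b0.
pose l := k - a * o.1 - b * o.2.
have [S [SE sS]] := circle_line_meet o l r0 m0.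
have SE' : enumerates S ([set p | a * p.1 + b * p.2 = k] `&` circ o r).
  case: SE => uS SE; split=> // p; rewrite -SE /= /setI /l /=.
  by split=> -[h1 h2]; split=> //; move: h1 h2; lra.
rewrite /meet_once (enumerates_exists1 SE') sS nroots_eq1 => lE.
have l0 : l != 0.
  apply/negP => /eqP l0; move: lE; rewrite l0 expr0n subr0 => /eqP.
  by rewrite mulf_eq0 sqrf_eq0 (negbTE m0) (negbTE r1).
(* The equation of the line relative to [o] is rescaled to have constant [r]; tangency then makes
   its normal a unit vector. *)
exists (-1, r * a / l, r * b / l).
  transitivity (((a ^+ 2 + b ^+ 2) * r ^+ 2 - l ^+ 2) / l ^+ 2).
    by rewrite /lor3 /=; field.
  by rewrite lE mul0r.
rewrite obj_line ?addNr //=; apply/seteqP; split=> p /= h.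
  transitivity (r / l * (k - a * o.1 - b * o.2)); last by rewrite divfK.
  by rewrite -h; ring.
have : r / l * (a * p.1 + b * p.2 - k) = 0.
  transitivity (r * a / l * (p.1 - o.1) + r * b / l * (p.2 - o.2) -
      r / l * (k - a * o.1 - b * o.2)); first by ring.
  by rewrite h -/l divfK // subrr.
move=> /eqP; rewrite !mulf_eq0 invr_eq0 (negbTE r1) (negbTE l0) /= subr_eq0.
by move/eqP.
Qed.

Lemma gapcC (R : realType) (b : bool) (c c' : R * R) (r s : R) :
  gapc b c r c' s = gapc b c' s c r.
Proof. by rewrite /gapc sqdC /gap; case: b; ring. Qed.

Lemma tangent_objP (R : realType) (o : R * R) (r : R) (D : set (R * R)) :
  0 < r -> tangent D (circ o r) ->
  (exists p, D = [set p] /\ circ o r p) \/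
  exists2 v, lor3 v v = 0 & D = obj o r v.
Proof.
move=> r0 [[[c [s [s0 ->]]] t]|[L t]|]; last by left.
  right; apply: circle_objP => //.
  have [e|e] := (tangent_circ c o s0 r0).1 t; by [exists false|exists true].
by right; apply: line_objP.
Qed.

Lemma tangent_obj (R : realType) (o c : R * R) (r s : R) (v : R * R * R) :
  0 < r -> 0 < s -> lor3 v v = 0 ->
  tangent (obj o r v) (circ c s) <->
  exists b, dot3 (relvec o r c s) v = gapc b o r c s.
Proof.
move=> r0 s0 vv; rewrite -obj_tangent //; split.
  case=> [[_ //]|[_ t]|[p [E _]]]; first by right.
  by have := obj_not_set1 r0 vv E.
have [[c' [s' [s0' cE _]]]|[L u]] := obj_kind o r0 vv => t.
  by constructor 1; rewrite cE in t *; split=> //; exact: is_circle_circ.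
constructor 2; split=> //; case: t => // E.
by exfalso; apply: (@circ_not_line _ c _ s0); rewrite -E.
Qed.

Lemma tangent_set1 (R : realType) (c : R * R) (s : R) (p : R * R) :
  0 < s -> tangent [set p] (circ c s) <-> circ c s p.
Proof.
move=> s0; split=> [|h]; last by constructor 3; exists p.
case=> [[[c' [s' [s0' E]]] _]|[L _]|[q [E]]].
- by have := @circ_not_set1 _ c' s' p s0' (esym E).
- by have := @line_not_set1 _ _ p L erefl.
- by have -> : p = q; [have : [set p] p by []; rewrite E|].
Qed.

Definition nonpoint (R : realType) (c : 'I_3 -> R * R) (r : 'I_3 -> R)
    (i j k : 'I_3) (b b' : bool) : set (R * R * R) :=
  contact b b' (r i) ((c j).1 - (c i).1) ((c j).2 - (c i).2) (r j)
    ((c k).1 - (c i).1) ((c k).2 - (c i).2) (r k).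

(** * Counting solutions and intersection points *)

Definition circles (R : realType) (c : 'I_3 -> R * R) (r : 'I_3 -> R)
    (i : 'I_3) : set (R * R) := circ (c i) (r i).

Definition gapij (R : realType) (c : 'I_3 -> R * R) (r : 'I_3 -> R)
    (b : bool) (i j : 'I_3) : R := gapc b (c i) (r i) (c j) (r j).

Lemma gapijC (R : realType) (c : 'I_3 -> R * R) (r : 'I_3 -> R) b i j :
  gapij c r b i j = gapij c r b j i.
Proof. exact: gapcC. Qed.

Definition triple_cover (i j k : 'I_3) : Prop :=
  [/\ i != j, i != k, j != k & forall m, [\/ m = i, m = j | m = k]].

Lemma triple_coverP (i j k : 'I_3) :
  i != j -> i != k -> j != k -> triple_cover i j k.
Proof.
move=> ij ik jk; split=> // m.
have : [|| m == i, m == j | m == k].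
  move: ij ik jk (ltn_ord i) (ltn_ord j) (ltn_ord k) (ltn_ord m).
  by rewrite -!val_eqE /=; lia.
by case/or3P => /eqP ->; [constructor 1|constructor 2|constructor 3].
Qed.

Lemma nonpointP (R : realType) (c : 'I_3 -> R * R) (r : 'I_3 -> R)
    (i j k : 'I_3) (b b' : bool) (v : R * R * R) :
  nonpoint c r i j k b b' v <->
  [/\ lor3 v v = 0, dot3 (relvec (c i) (r i) (c j) (r j)) v = gapij c r b i j &
    dot3 (relvec (c i) (r i) (c k) (r k)) v = gapij c r b' i k].
Proof. by rewrite /gapij /gapc sqdC (sqdC (c i) (c k)). Qed.

Lemma gap3E (R : realType) (c : 'I_3 -> R * R) (r : 'I_3 -> R)
    (i j k : 'I_3) (b b' : bool) :
  gap3 b b' (r i) ((c j).1 - (c i).1) ((c j).2 - (c i).2) (r j)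
    ((c k).1 - (c i).1) ((c k).2 - (c i).2) (r k) =
  gapij c r b i j * gapij c r b' i k * gapij c r (b (+) b') j k.
Proof.
rewrite /gapij /gapc sqdC (sqdC (c i) (c k)) /gap3; congr (_ * _).
by congr gap; rewrite /sqd; ring.
Qed.

Lemma solutionsE (R : realType) (c : 'I_3 -> R * R) (r : 'I_3 -> R)
    (i j k : 'I_3) : (forall i, 0 < r i) -> triple_cover i j k ->
  solutions (circles c r) =
  obj (c i) (r i) @` [set v | exists b b', nonpoint c r i j k b b' v] `|`
  set1 @` double_points (circles c r).
Proof.
move=> r0 [ij ik jk cov]; apply/seteqP; split=> [D DP|D].
  have [[p [DE _]]|[v vv DE]] := tangent_objP (r0 i) (DP i).
    by right; exists p => // m; apply/(tangent_set1 _ _ (r0 m)); rewrite -DE; exact: DP.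
  left; exists v => //; rewrite DE in DP.
  have [b bE] := (tangent_obj _ _ (r0 i) (r0 j) vv).1 (DP j).
  have [b' b'E] := (tangent_obj _ _ (r0 i) (r0 k) vv).1 (DP k).
  by exists b, b'; apply/nonpointP.
case=> [[v [b [b' /nonpointP[vv bE b'E]]] <-]|[p pP <-]] m; last first.
  by apply/tangent_set1 => //; exact: pP.
apply/tangent_obj => //; have [->|->|->] := cov m; [|by exists b|by exists b'].
(* Relative to itself the base circle has normal zero and internal gap zero, so every [v] satisfies
   its contact equation. *)
exists false; rewrite /gapc /gap /relvec /nvec /dot3 /sqd /= !subrr; ring.
Qed.

Lemma nonpoint_disjoint (R : realType) (c : 'I_3 -> R * R) (r : 'I_3 -> R)
    (i j k : 'I_3) (b b' d d' : bool) (v : R * R * R) :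
  (forall i, 0 < r i) -> nonpoint c r i j k b b' v ->
  nonpoint c r i j k d d' v -> (b, b') = (d, d').
Proof.
move=> r0 /nonpointP[_ e1 e2] /nonpointP[_]; rewrite e1 e2.
(* The two gaps differ by [4 r_i r_l], so [v] determines its relative orientations. *)
have inj l : injective (fun b => gapij c r b i l).
  move=> a a' /eqP; rewrite -subr_eq0 /gapij /gapc /gap => /eqP e.
  have : 4 * (r i * r l) != 0 by rewrite !mulf_neq0 ?pnatr_eq0 // lt0r_neq0.
  by case: a a' e => [] [] // e /eqP[]; move: e; lra.
by move=> /inj -> /inj ->.
Qed.

Lemma solutions_enum (R : realType) (c : 'I_3 -> R * R) (r : 'I_3 -> R)
    (i j k : 'I_3) (S : bool -> bool -> seq (R * R * R)) (P : seq (R * R)) :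
  (forall i, 0 < r i) -> triple_cover i j k ->
  (forall b b', enumerates (S b b') (nonpoint c r i j k b b')) ->
  enumerates P (double_points (circles c r)) ->
  (solutions (circles c r) #= `I_(size (S false false) + size (S false true) +
    size (S true false) + size (S true true) + size P))%card.
Proof.
move=> r0 cov SE PE; rewrite (solutionsE c r0 cov).
have disj b b' d d' v : (b, b') != (d, d') ->
    nonpoint c r i j k b b' v -> ~ nonpoint c r i j k d d' v.
  by move=> /eqP ne h h'; apply: ne; exact: nonpoint_disjoint r0 h h'.
set A := [set v | _].
pose L := ((S false false ++ S false true) ++ S true false) ++ S true true.
have AE : enumerates L A.
  have -> : A = ((nonpoint c r i j k false false `|`
      nonpoint c r i j k false true) `|` nonpoint c r i j k true false) `|`
      nonpoint c r i j k true true.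
    apply/seteqP; split=> v /=.
      by case=> -[] [[]]; [right|left; right|left; left; right|left; left; left].
    by case=> [[[]|]|] h; do 2 eexists; exact: h.
  do 3 ?apply: enumerates_cat => //.
  - by move=> v; exact: disj.
  - by move=> v [] h; apply: disj h.
  - by move=> v [[]|] h; apply: disj h.
have A0 v : A v -> lor3 v v = 0 by case=> b [b' /nonpointP[]].
have OE : enumerates (map (obj (c i) (r i)) L) (obj (c i) (r i) @` A).
  apply: (enumerates_map _ AE) => [v w /A0 vv /A0 ww|D].
    exact: obj_inj.
  by split=> -[v ? ?]; exists v.
have QE : enumerates (map set1 P) (set1 @` double_points (circles c r)).
  apply: (enumerates_map _ PE) => [p q _ _ E|D].
    by have : [set p] p by []; rewrite E.
  by split=> -[v ? ?]; exists v.
have := enumerates_card (enumerates_cat OE QE _).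
rewrite size_cat !size_map !size_cat; apply => _ [v /A0 vv <-] [p _ /esym].
exact: obj_not_set1.
Qed.

Lemma solutions_infinite (R : realType) (c : 'I_3 -> R * R) (r : 'I_3 -> R)
    (i j k : 'I_3) (b b' : bool) :
  (forall i, 0 < r i) -> triple_cover i j k ->
  infinite_set (nonpoint c r i j k b b') ->
  infinite_set (solutions (circles c r)).
Proof.
move=> r0 cov inf; rewrite (solutionsE c r0 cov).
apply: (@sub_infinite_set _ (obj (c i) (r i) @` nonpoint c r i j k b b')).
  by move=> _ [v vP <-]; left; exists v => //; exists b, b'.
have /[!card_eq_le]/andP[_ le] : (obj (c i) (r i) @` nonpoint c r i j k b b' #=
    nonpoint c r i j k b b')%card.
  apply: inj_card_eq => v w; rewrite !inE => /nonpointP[vv _ _].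
  by move=> /nonpointP[ww _ _]; exact: obj_inj.
by apply: contra_not inf => /(card_le_finite le).
Qed.

Lemma common3P (R : realType) (c : 'I_3 -> R * R) (r : 'I_3 -> R)
    (i j k : 'I_3) (p : R * R) :
  (forall i, 0 < r i) -> triple_cover i j k ->
  double_points (circles c r) p <->
  common3 (r i) ((c j).1 - (c i).1) ((c j).2 - (c i).2) (r j)
    ((c k).1 - (c i).1) ((c k).2 - (c i).2) (r k)
    (p.1 - (c i).1) (p.2 - (c i).2).
Proof.
move=> r0 [_ _ _ cov]; rewrite /common3 !opprB !addrA !subrK.
have cP m : circles c r m p <-> sqd p (c m) = r m ^+ 2.
  exact: circP (ltW (r0 m)).
split=> [h|[/cP hi /cP hj /cP hk] m]; first by split; apply/cP/h.
by have [->|->|->] := cov m.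
Qed.

Lemma rel_neq (R : realType) (o c c' : R * R) (s s' : R) :
  (c, s) <> (c', s') ->
  (c.1 - o.1, c.2 - o.2, s) <> (c'.1 - o.1, c'.2 - o.2, s').
Proof.
move=> ne [/addIr e1 /addIr e2 e3]; apply: ne.
by rewrite e3; case: c c' e1 e2 => [? ?] [? ?] /= -> ->.
Qed.

Lemma rel_neq0 (R : realType) (o c : R * R) (s r : R) :
  (c, s) <> (o, r) -> (c.1 - o.1, c.2 - o.2, s) <> (0, 0, r).
Proof. by move=> /(rel_neq (o := o)); rewrite !subrr. Qed.

Lemma nonpoint_no_double (R : realType) (c : 'I_3 -> R * R) (r : 'I_3 -> R)
    (i j k : 'I_3) (b b' : bool) :
  (forall i, 0 < r i) -> injective (fun i => (c i, r i)) ->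
  triple_cover i j k -> ~ has_double_points (circles c r) ->
  exists S, enumerates S (nonpoint c r i j k b b') /\
    size S = nroots (- (gapij c r b i j * gapij c r b' i k *
      gapij c r (b (+) b') j k)).
Proof.
move=> r0 inj cov nod; rewrite -gap3E; have [/eqP ij /eqP ik /eqP jk _] := cov.
apply: contact_no_common => //.
- by apply: rel_neq0 => /inj/esym.
- by apply: rel_neq0 => /inj/esym.
- by apply: rel_neq => /inj.
- case=> X [Y XY]; apply: nod; exists (X + (c i).1, Y + (c i).2).
  by apply/(@common3P _ c r i j k _ r0 cov); rewrite /= !addrK.
Qed.

Definition nsol (R : realType) (c : 'I_3 -> R * R) (r : 'I_3 -> R)
    (i j k : 'I_3) (b b' : bool) : nat :=
  nroots (- (gapij c r b i j * gapij c r b' i k * gapij c r (b (+) b') j k)).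

Lemma solutions_no_double (R : realType) (c : 'I_3 -> R * R) (r : 'I_3 -> R)
    (i j k : 'I_3) :
  (forall i, 0 < r i) -> injective (fun i => (c i, r i)) ->
  triple_cover i j k -> ~ has_double_points (circles c r) ->
  (solutions (circles c r) #= `I_(nsol c r i j k false false +
    nsol c r i j k false true + nsol c r i j k true false +
    nsol c r i j k true true))%card.
Proof.
move=> r0 inj cov nod.
have /choice[S SE] : forall bb : bool * bool, exists S,
    enumerates S (nonpoint c r i j k bb.1 bb.2) /\
    size S = nsol c r i j k bb.1 bb.2.
  by move=> [b b']; exact: nonpoint_no_double.
have := @solutions_enum _ c r i j k (fun b b' => S (b, b')) [::] r0 cov.
rewrite addn0 !(SE _).2; apply=> [b b'|]; first exact: (SE (b, b')).1.
by apply: enumerates_nil => p dp; apply: nod; exists p.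
Qed.

Definition nmeet (R : realType) (c : 'I_3 -> R * R) (r : 'I_3 -> R)
    (i j : 'I_3) : nat :=
  nroots (- (gapij c r false i j * gapij c r true i j)).

Definition tang (R : realType) (c : 'I_3 -> R * R) (r : 'I_3 -> R)
    (i j : 'I_3) : bool := gapij c r false i j * gapij c r true i j == 0.

Lemma tangC (R : realType) (c : 'I_3 -> R * R) (r : 'I_3 -> R) i j :
  tang c r i j = tang c r j i.
Proof. by rewrite /tang !(gapijC _ _ _ i). Qed.

Lemma nmeet_tang (R : realType) (c : 'I_3 -> R * R) (r : 'I_3 -> R) i j :
  tang c r i j <-> nmeet c r i j = 1%N.
Proof.
rewrite /tang /nmeet nroots_eq1; split=> [/eqP ->|/eqP]; first exact: oppr0.
by rewrite oppr_eq0.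
Qed.

Lemma circle_tangentP (R : realType) (c : 'I_3 -> R * R) (r : 'I_3 -> R) i j :
  (forall i, 0 < r i) ->
  circle_tangent (circles c r i) (circles c r j) <-> tang c r i j.
Proof.
move=> r0; rewrite /tang mulf_eq0; split.
  by case=> _ /(tangent_circ _ _ (r0 i) (r0 j))[]/eqP; rewrite /gapij => ->;
    rewrite ?orbT.
move=> h; split; first exact: is_circle_circ.
by apply/(tangent_circ _ _ (r0 i) (r0 j)); case/orP: h => /eqP; [left|right].
Qed.

Lemma meet_enum (R : realType) (c : 'I_3 -> R * R) (r : 'I_3 -> R) i j :
  (forall i, 0 < r i) -> injective (fun i => (c i, r i)) -> i <> j ->
  exists S, enumerates S (circles c r i `&` circles c r j) /\
    size S = nmeet c r i j.
Proof.
by move=> r0 inj ij; apply: circle_circle_meet => // /inj.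
Qed.

Lemma pairs_cover (i j k : 'I_3) (Q : 'I_3 -> 'I_3 -> Prop) :
  triple_cover i j k -> (forall m n, Q m n -> Q n m) ->
  (exists m n, m <> n /\ Q m n) <-> [\/ Q i j, Q i k | Q j k].
Proof.
move=> [/eqP ij /eqP ik /eqP jk cov] sym; split; last first.
  by case=> h; [exists i, j|exists i, k|exists j, k].
move=> [m [n [mn h]]]; have h' := sym _ _ h.
have [e|e|e] := cov m; have [f|f|f] := cov n; rewrite e f in mn h h' *;
 by [|constructor 1|constructor 2|constructor 3].
Qed.

Lemma intersection_pointsE (R : realType) (C : 'I_3 -> set (R * R)) i j k :
  triple_cover i j k ->
  intersection_points C = ((C i `&` C j) `|` (C i `&` C k)) `|` (C j `&` C k).
Proof.
move=> cov; apply/seteqP.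
have E p : intersection_points C p <->
    [\/ (C i `&` C j) p, (C i `&` C k) p | (C j `&` C k) p].
  rewrite -(@pairs_cover _ _ _ (fun m n => (C m `&` C n) p) cov).
    by split=> [[m [n [? ? ?]]]|[m [n [? [? ?]]]]]; exists m, n.
  by move=> m n [].
split=> p; first by case/E => h; [left; left|left; right|right].
by case=> [[|]|] h; apply/E; [constructor 1|constructor 2|constructor 3].
Qed.

Lemma tangency_pointsE (R : realType) (c : 'I_3 -> R * R) (r : 'I_3 -> R)
    i j k : (forall i, 0 < r i) -> triple_cover i j k ->
  let T m n := [set p | tang c r m n /\ (circles c r m `&` circles c r n) p] in
  tangency_points (circles c r) = (T i j `|` T i k) `|` T j k.
Proof.
move=> r0 cov T; apply/seteqP.
have E p : tangency_points (circles c r) p <-> [\/ T i j p, T i k p | T j k p].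
  rewrite -(@pairs_cover _ _ _ (fun m n => T m n p) cov); last first.
    by move=> m n [t [? ?]]; split; rewrite 1?tangC.
  split=> [[m [n [? /(circle_tangentP _ _ _ r0) ? ? ?]]]|[m [n [? [? [? ?]]]]]];
    by exists m, n; split=> //; apply/circle_tangentP.
split=> p; first by case/E => h; [left; left|left; right|right].
by case=> [[|]|] h; apply/E; [constructor 1|constructor 2|constructor 3].
Qed.

Lemma has_tangent_circlesE (R : realType) (c : 'I_3 -> R * R) (r : 'I_3 -> R)
    i j k : (forall i, 0 < r i) -> triple_cover i j k ->
  has_tangent_circles (circles c r) <->
  [|| tang c r i j, tang c r i k | tang c r j k].
Proof.
move=> r0 cov.
have := @pairs_cover _ _ _ (fun m n => tang c r m n) cov.
rewrite /has_tangent_circles => E; split=> [[m [n [mn t]]]|/or3P/E h].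
  by apply/or3P/E; [move=> ? ?; rewrite tangC|exists m, n; split=> //; apply/circle_tangentP].
have [|m [n [mn t]]] := h; first by move=> ? ?; rewrite tangC.
by exists m, n; split=> //; apply/circle_tangentP.
Qed.

(** Without a double point the three pairwise intersections are disjoint, so their sizes add; a
    tangent pair contributes a single point. *)
Lemma meets_no_double (R : realType) (c : 'I_3 -> R * R) (r : 'I_3 -> R)
    i j k : (forall i, 0 < r i) -> injective (fun i => (c i, r i)) ->
  triple_cover i j k -> ~ has_double_points (circles c r) ->
  (intersection_points (circles c r) #=
     `I_(nmeet c r i j + nmeet c r i k + nmeet c r j k))%card /\
  (tangency_points (circles c r) #=
     `I_(tang c r i j + tang c r i k + tang c r j k))%card.
Proof.
move=> r0 inj cov nod; have [/eqP ij /eqP ik /eqP jk covm] := cov.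
have no3 p : circles c r i p -> circles c r j p -> circles c r k p -> False.
  by move=> hi hj hk; apply: nod; exists p => m; have [->|->|->] := covm m.
have [S1 [E1 s1]] := meet_enum r0 inj ij.
have [S2 [E2 s2]] := meet_enum r0 inj ik.
have [S3 [E3 s3]] := meet_enum r0 inj jk.
split.
  rewrite (intersection_pointsE _ cov) -s1 -s2 -s3 -!size_cat.
  apply: enumerates_card; do 2 ?apply: enumerates_cat => //.
    by move=> p [hi hj] [_ hk]; exact: no3 hi hj hk.
  by move=> p [[hi hj] [_ hk]|[hi hk] [hj _]]; exact: no3 hi hj hk.
rewrite (tangency_pointsE c r0 cov) /=.
have TE m n S : enumerates S (circles c r m `&` circles c r n) ->
    size S = nmeet c r m n ->
    enumerates (if tang c r m n then S else [::])
      [set p | tang c r m n /\ (circles c r m `&` circles c r n) p] /\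
    size (if tang c r m n then S else [::]) = tang c r m n.
  move=> [uS SE] sS; case: ifP => t; last by split=> //; apply: enumerates_nil => p [].
  by split; [split=> // p; rewrite -SE; split=> [[]|]|rewrite sS; apply/nmeet_tang].
have [F1 <-] := TE _ _ _ E1 s1; have [F2 <-] := TE _ _ _ E2 s2.
have [F3 <-] := TE _ _ _ E3 s3; rewrite -!size_cat.
apply: enumerates_card; do 2 ?apply: enumerates_cat => //.
  by move=> p [_ [hi hj]] [_ [_ hk]]; exact: no3 hi hj hk.
by move=> p [[_ [hi hj]] [_ [_ hk]]|[_ [hi hk]] [_ [hj _]]]; exact: no3 hi hj hk.
Qed.

(** * Components of the complement of a circle *)

Definition inside (R : realType) (c : R * R) (r : R) : set (R * R) :=
  [set p | sqd p c < r ^+ 2].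

Definition outside (R : realType) (c : R * R) (r : R) : set (R * R) :=
  [set p | r ^+ 2 < sqd p c].

Lemma continuous_sqd (R : realType) (c : R * R) :
  continuous (fun p : R * R => sqd p c).
Proof.
move=> p; rewrite /sqd; apply: cvgD.
  apply: (@cvg_comp _ _ _ (fun p : R * R => p.1 - c.1) (fun x : R => x ^+ 2)).
    by apply: cvgB; [exact: cvg_fst|exact: cvg_cst].
  exact: exprn_continuous.
apply: (@cvg_comp _ _ _ (fun p : R * R => p.2 - c.2) (fun x : R => x ^+ 2)).
  by apply: cvgB; [exact: cvg_snd|exact: cvg_cst].
exact: exprn_continuous.
Qed.

(* [polar c a b s t] runs from [c + a (1, 0)] to [c + b (cos s, sin s)]. *)
Definition polar (R : realType) (c : R * R) (a b s t : R) : R * R :=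
  (c.1 + (a + t * (b - a)) * cos (t * s), c.2 + (a + t * (b - a)) * sin (t * s)).

Lemma continuous_polar (R : realType) (c : R * R) (a b s : R) :
  continuous (polar c a b s).
Proof.
have lin u v : continuous (fun t : R => u + t * v).
  by move=> t; apply: cvgD; [exact: cvg_cst|apply: cvgM; [exact: cvg_id|exact: cvg_cst]].
have ang : continuous (fun t : R => t * s).
  by move=> t; apply: cvgM; [exact: cvg_id|exact: cvg_cst].
have p1 : continuous (fun t : R => c.1 + (a + t * (b - a)) * cos (t * s)).
  move=> t; apply: cvgD; first exact: cvg_cst.
  apply: cvgM; first exact: lin.
  apply: (@cvg_comp _ _ _ (fun t : R => t * s) cos); first exact: ang.
  exact: continuous_cos.
have p2 : continuous (fun t : R => c.2 + (a + t * (b - a)) * sin (t * s)).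
  move=> t; apply: cvgD; first exact: cvg_cst.
  apply: cvgM; first exact: lin.
  apply: (@cvg_comp _ _ _ (fun t : R => t * s) sin); first exact: ang.
  exact: continuous_sin.
by move=> t; exact: cvg_pair (p1 t) (p2 t).
Qed.

Lemma sqd_polar (R : realType) (c : R * R) (a b s t : R) :
  sqd (polar c a b s t) c = (a + t * (b - a)) ^+ 2.
Proof.
rewrite /sqd /polar /= -[RHS]mulr1 -(cos2Dsin2 (t * s)); ring.
Qed.

(** At time 1 the starting offset [a] cancels, so one angle serves all [a]. *)
Lemma polarP (R : realType) (c p : R * R) :
  exists2 rho, 0 <= rho & exists s, forall a, p = polar c a rho s 1.
Proof.
pose rho := Num.sqrt (sqd p c); exists rho; first exact: sqrtr_ge0.
have rho2 : rho ^+ 2 = sqd p c by rewrite sqr_sqrtr // sqd_ge0.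
have [d0|d0] := eqVneq (sqd p c) 0.
  exists 0 => a; rewrite /polar (_ : a + 1 * (rho - a) = rho); last by ring.
  by rewrite /rho d0 sqrtr0 !mul0r !addr0 (sqd_eq0 d0); case: (c).
have rho0 : rho != 0 by rewrite -sqrf_eq0 rho2.
pose x := (p.1 - c.1) / rho; pose y := (p.2 - c.2) / rho.
have xy : x ^+ 2 + y ^+ 2 = 1.
  by rewrite /x /y !expr_div_n -mulrDl rho2 divff.
have x1 : -1 <= x <= 1.
  by have y2 := sqr_ge0 y; apply/andP; split; nra.
have [s [cs ss]] : exists s, cos s = x /\ sin s = y.
  have sa : sin (acos x) = `|y|.
    by rewrite sin_acos // -xy addrC addKr sqrtr_sqr.
  have ca : cos (acos x) = x by apply: acosK; rewrite in_itv.
  have [y0|y0] := leP 0 y.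
    by exists (acos x); rewrite ca sa ger0_norm.
  by exists (- acos x); rewrite cosN sinN ca sa ltr0_norm // opprK.
exists s => a; rewrite /polar (_ : a + 1 * (rho - a) = rho); last by ring.
rewrite !mul1r cs ss /x /y.
by case: (p) => u v /=; congr pair; rewrite mulrC divfK // subrKC.
Qed.

(** Spirals from a common starting point treat both sides of a circle alike: the disc uses [a = 0],
    the exterior [a = r + 1]. Straight segments could leave the exterior, whereas along a spiral the
    radius stays between its two end values. *)
Lemma polar_connected (R : realType) (c : R * R) (a : R) (A : set (R * R)) :
  (forall rho s t, 0 <= rho -> A (polar c a rho s 1) -> 0 <= t <= 1 ->
    A (polar c a rho s t)) ->
  connected A.
Proof.
move=> Apath.
pose P (q : R * R) : Prop := 0 <= q.1 /\ A (polar c a q.1 q.2 1).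
have -> : A = \bigcup_(q in P) (polar c a q.1 q.2 @` `[0, 1]).
  apply/seteqP; split=> [p Ap|_ [q [q0 Aq] [t t01 <-]]]; last first.
    by apply: Apath => //; move: t01; rewrite /= in_itv.
  have [rho rho0 [s pE]] := polarP c p.
  exists (rho, s); first by split=> //=; rewrite -pE.
  by exists 1; rewrite /= -?pE // in_itv /= ler01 lexx.
apply: bigcup_connected.
  exists (c.1 + a, c.2) => q _; exists 0; first by rewrite /= in_itv /= lexx ler01.
  by rewrite /polar !mul0r cos0 sin0 mulr1 mulr0 !addr0.
move=> q _; apply: connected_continuous_connected; first exact: segment_connected.
by apply: continuous_subspaceT; exact: continuous_polar.
Qed.

Lemma inside_connected (R : realType) (c : R * R) (r : R) :
  connected (inside c r).
Proof.
apply: (@polar_connected _ c 0) => rho s t rho0.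
rewrite /inside /= !sqd_polar subr0 !add0r mul1r => rhor /andP[t0 t1].
apply: le_lt_trans rhor; rewrite exprMn ler_piMl ?sqr_ge0 //.
by rewrite exprn_ile1.
Qed.

Lemma outside_connected (R : realType) (c : R * R) (r : R) :
  0 < r -> connected (outside c r).
Proof.
move=> r0; apply: (@polar_connected _ c (r + 1)) => rho s t rho0.
rewrite /outside /= !sqd_polar (_ : r + 1 + 1 * (rho - (r + 1)) = rho); last by ring.
move=> rhor /andP[t0 t1].
have rr : r < rho by move: rhor; rewrite ltr_pXn2r // nnegrE ltW.
by rewrite ltr_pXn2r // ?nnegrE ?ltW //; nra.
Qed.

Lemma compl_circ (R : realType) (c : R * R) (r : R) : 0 < r ->
  ~` circ c r = inside c r `|` outside c r.
Proof.
move=> r0; apply/seteqP; split=> p /=; rewrite (circP _ _ (ltW r0)).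
  by move=> /eqP; rewrite neq_lt => /orP[]; [left|right].
by move=> [|] h e; move: h; rewrite /inside /outside /= e ltxx.
Qed.

Lemma connected_compl_circ (R : realType) (c : R * R) (r : R)
    (B : set (R * R)) :
  0 < r -> connected B -> B `<=` ~` circ c r ->
  B `<=` inside c r \/ B `<=` outside c r.
Proof.
move=> r0 Bc BA; have [h|] := pselect (B `<=` inside c r); first by left.
move=> /existsNP[p /not_implyP[Bp pN]]; right=> q Bq.
have po : outside c r p.
  by have := BA _ Bp; rewrite compl_circ // => -[].
have := BA _ Bq; rewrite compl_circ // => -[qi|//]; exfalso.
(* Intermediate values: a connected set with points on both sides has a point at squared distance
   [r ^+ 2], that is, on the circle. *)
have /connected_intervalP itv : connected ((fun p => sqd p c) @` B).
  apply: connected_continuous_connected => //.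
  by apply: continuous_subspaceT; exact: continuous_sqd.
have [|z Bz zE] := itv _ _ (ex_intro2 _ _ q Bq erefl)
  (ex_intro2 _ _ p Bp erefl) (r ^+ 2).
  by rewrite (ltW qi) (ltW po).
by apply: (BA _ Bz); apply/(circP _ _ (ltW r0)).
Qed.

Lemma component_circP (R : realType) (c : R * R) (r : R) (U : set (R * R)) :
  0 < r -> is_component (~` circ c r) U <-> U = inside c r \/ U = outside c r.
Proof.
move=> r0.
have disj p : inside c r p -> outside c r p -> False.
  by move=> h1 h2; have := lt_trans h1 h2; rewrite ltxx.
have cE p : (inside c r p -> connected_component (~` circ c r) p = inside c r) /\
    (outside c r p -> connected_component (~` circ c r) p = outside c r).
  have refl : (~` circ c r) p -> connected_component (~` circ c r) p p.
    exact: connected_component_refl.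
  have sub := connected_compl_circ r0 (@component_connected _ (~` circ c r) p)
    (@connected_component_sub _ _ _).
  split=> hp; apply/seteqP; split.
  - case: sub => // h; exfalso; apply: (disj p hp (h _ (refl _))).
    by rewrite compl_circ //; left.
  - apply: connected_component_max => //; last exact: inside_connected.
    by rewrite compl_circ // => q ?; left.
  - case: sub => // h; exfalso; apply: (disj p (h _ (refl _)) hp).
    by rewrite compl_circ //; right.
  - apply: connected_component_max => //; last exact: outside_connected.
    by rewrite compl_circ // => q ?; right.
split=> [[p [pA ->]]|].
  have : (inside c r `|` outside c r) p by rewrite -compl_circ.
  by case=> [/(cE p).1|/(cE p).2] ->; [left|right].
have ic : inside c r c by rewrite /inside /= /sqd !subrr expr0n addr0 exprn_gt0.
have oc : outside c r (c.1 + (r + r), c.2).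
  rewrite /outside /= (_ : sqd _ c = r ^+ 2 *+ 4); last by rewrite /sqd /=; ring.
  by rewrite -subr_gt0 -[X in _ - X]mulr1n -mulrnBr // pmulrn_lgt0 // exprn_gt0.
case=> ->.
  by exists c; rewrite (cE c).1 //; split=> //; rewrite compl_circ //; left.
exists (c.1 + (r + r), c.2); rewrite (cE _).2 //; split=> //.
by rewrite compl_circ //; right.
Qed.

Lemma closure_radial (R : realType) (c p : R * R) (A : set (R * R)) :
  (forall e : R, 0 < e -> exists t, `|1 - t| < e /\
    A (c.1 + t * (p.1 - c.1), c.2 + t * (p.2 - c.2))) ->
  closure A p.
Proof.
move=> Ap B Bp; pose f (t : R) := (c.1 + t * (p.1 - c.1), c.2 + t * (p.2 - c.2)).
have lin u v : continuous (fun t : R => u + t * v).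
  by move=> t; apply: cvgD; [exact: cvg_cst|apply: cvgM; [exact: cvg_id|exact: cvg_cst]].
have f1 : f 1 = p by rewrite /f !mul1r !subrKC; case: (p).
have fc : {for 1, continuous f} by exact: cvg_pair (lin _ _ 1) (lin _ _ 1).
have /fc/nbhs_ballP[e /= e0 eB] : nbhs (f 1) B by rewrite f1.
have [t [te At]] := Ap _ e0.
by exists (f t); split=> //; exact: eB.
Qed.

Lemma closure_inside (R : realType) (c : R * R) (r : R) : 0 < r ->
  closure (inside c r) = [set p | sqd p c <= r ^+ 2].
Proof.
move=> r0; apply/seteqP; split.
  have cl : closed [set p | sqd p c <= r ^+ 2].
    apply: (@preimage_closed _ _ (fun p => sqd p c) [set x | x <= r ^+ 2]).
      by move=> ? _; exact: continuous_sqd.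
    exact: closed_le.
  rewrite [X in _ `<=` X](closure_id _).1 //; apply: closureS => p; exact: ltW.
move=> p /= pr; apply: (closure_radial (c := c)) => e e0.
(* The bound 1 keeps [1 - d] in [[0, 1)], so that its square is less than 1 for large [e] too. *)
pose d := Num.min (e / 2) 1; exists (1 - d).
have d0 : 0 < d by rewrite lt_min ltr01 divr_gt0.
have d1 : d <= 1 by rewrite ge_min lexx orbT.
have de : d < e by rewrite gt_min (_ : e / 2 < e) //; lra.
rewrite opprB addrC subrK gtr0_norm //; split=> //.
rewrite /inside /=; have -> : sqd (c.1 + (1 - d) * (p.1 - c.1),
    c.2 + (1 - d) * (p.2 - c.2)) c = (1 - d) ^+ 2 * sqd p c.
  by rewrite /sqd /=; ring.
have h : (1 - d) ^+ 2 < 1 by nra.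
have r2 : 0 < r ^+ 2 by rewrite exprn_gt0.
apply: le_lt_trans (_ : (1 - d) ^+ 2 * r ^+ 2 < _).
  by rewrite ler_wpM2l // sqr_ge0.
by rewrite gtr_pMl.
Qed.

Lemma closure_outside (R : realType) (c : R * R) (r : R) : 0 < r ->
  closure (outside c r) = [set p | r ^+ 2 <= sqd p c].
Proof.
move=> r0; apply/seteqP; split.
  have cl : closed [set p | r ^+ 2 <= sqd p c].
    apply: (@preimage_closed _ _ (fun p => sqd p c) [set x | r ^+ 2 <= x]).
      by move=> ? _; exact: continuous_sqd.
    exact: closed_ge.
  rewrite [X in _ `<=` X](closure_id _).1 //; apply: closureS => p; exact: ltW.
move=> p /= pr; apply: (closure_radial (c := c)) => e e0.
exists (1 + e / 2); split.
  by rewrite opprD addrA subrr add0r normrN gtr0_norm; lra.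
rewrite /outside /=; have -> : sqd (c.1 + (1 + e / 2) * (p.1 - c.1),
    c.2 + (1 + e / 2) * (p.2 - c.2)) c = (1 + e / 2) ^+ 2 * sqd p c.
  by rewrite /sqd /=; ring.
have h : 1 < (1 + e / 2) ^+ 2 by nra.
have r2 : 0 < r ^+ 2 by rewrite exprn_gt0.
apply: lt_le_trans (_ : (1 + e / 2) ^+ 2 * r ^+ 2 <= _).
  by rewrite ltr_pMl.
by rewrite ler_wpM2l // sqr_ge0.
Qed.

(** * Inclusions between circles, discs and exteriors as inequalities between distances and radii *)

Definition dist (R : realType) (p q : R * R) : R := Num.sqrt (sqd p q).

Lemma dist_ge0 (R : realType) (p q : R * R) : 0 <= dist p q.
Proof. exact: sqrtr_ge0. Qed.

Lemma dist2 (R : realType) (p q : R * R) : dist p q ^+ 2 = sqd p q.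
Proof. by rewrite sqr_sqrtr // sqd_ge0. Qed.

Lemma distC (R : realType) (p q : R * R) : dist p q = dist q p.
Proof. by rewrite /dist sqdC. Qed.

Lemma circ_dist (R : realType) (c p : R * R) (r : R) :
  0 <= r -> circ c r p <-> dist p c = r.
Proof.
move=> r0; rewrite circP // -dist2; split=> [/eqP|-> //].
by rewrite eqrXn2 ?dist_ge0 // => /eqP.
Qed.

Lemma dist_triangle (R : realType) (p q s : R * R) :
  dist p s <= dist p q + dist q s.
Proof.
have d0 := dist_ge0 p q; have d1 := dist_ge0 q s.
rewrite -(@ler_pXn2r _ 2) ?nnegrE ?dist_ge0 ?addr_ge0 //.
rewrite sqrrD !dist2.
pose z := (p.1 - q.1) * (q.1 - s.1) + (p.2 - q.2) * (q.2 - s.2).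
have -> : sqd p s = sqd p q + z *+ 2 + sqd q s by rewrite /sqd /z; ring.
rewrite lerD2r lerD2l ler_pMn2r //; apply: le_trans (ler_norm z) _.
rewrite -(@ler_pXn2r _ 2) ?nnegrE ?mulr_ge0 // real_normK ?num_real //.
rewrite exprMn !dist2 -subr_ge0.
have -> : sqd p q * sqd q s - z ^+ 2 =
   ((p.1 - q.1) * (q.2 - s.2) - (p.2 - q.2) * (q.1 - s.1)) ^+ 2.
  by rewrite /sqd /z; ring.
exact: sqr_ge0.
Qed.

(** The line of centers meets the circle in its farthest and its nearest point from [c]; these two
    points decide every inclusion below. In the concentric case any direction serves. *)
Lemma circ_extremes (R : realType) (c c' : R * R) (s : R) : 0 < s ->
  exists2 u, circ c' s (c'.1 + u.1, c'.2 + u.2) /\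
             circ c' s (c'.1 - u.1, c'.2 - u.2) &
    dist (c'.1 + u.1, c'.2 + u.2) c = dist c' c + s /\
    dist (c'.1 - u.1, c'.2 - u.2) c = `|dist c' c - s|.
Proof.
move=> s0; set d := dist c' c.
have [n nn nd] : exists2 n : R * R, n.1 ^+ 2 + n.2 ^+ 2 = 1 &
    (n.1 * d = c'.1 - c.1) /\ (n.2 * d = c'.2 - c.2).
  have [d0|d0] := eqVneq d 0.
    have /sqd_eq0 -> : sqd c' c = 0 by rewrite -dist2 -/d d0 expr0n.
    by exists (1, 0) => /=; [ring|rewrite d0 !mulr0 !subrr].
  exists ((c'.1 - c.1) / d, (c'.2 - c.2) / d) => /=; last by rewrite !divfK.
  rewrite !expr_div_n -mulrDl -[X in X / _]/(sqd c' c) -dist2 divff //.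
  by rewrite sqrf_eq0.
have E t : sqd (c'.1 + t * n.1, c'.2 + t * n.2) c' = t ^+ 2.
  by rewrite -[RHS]mulr1 -nn /sqd /=; ring.
have F t : sqd (c'.1 + t * n.1, c'.2 + t * n.2) c = (d + t) ^+ 2.
  rewrite -[RHS]mulr1 -nn /sqd /=; case: nd => nd1 nd2.
  transitivity ((c'.1 - c.1 + t * n.1) ^+ 2 + (c'.2 - c.2 + t * n.2) ^+ 2).
    by ring.
  by rewrite -nd1 -nd2; ring.
have N x y : x - s * y = x + (- s) * y by rewrite mulNr.
exists (s * n.1, s * n.2) => /=; rewrite !N; split.
- by apply/(circP _ _ (ltW s0)); rewrite E.
- by apply/(circP _ _ (ltW s0)); rewrite E sqrrN.
- by rewrite /dist F sqrtr_sqr ger0_norm // addr_ge0 ?dist_ge0 // ltW.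
- by rewrite /dist F sqrtr_sqr.
Qed.

Section Subsets.
Variables (R : realType) (c c' : R * R) (r s : R).
Hypotheses (r0 : 0 < r) (s0 : 0 < s).

Lemma sqd_lt_dist p : (sqd p c < r ^+ 2) = (dist p c < r).
Proof. by rewrite -dist2 ltr_pXn2r // nnegrE ?dist_ge0 // ltW. Qed.

Lemma sqd_gt_dist p : (r ^+ 2 < sqd p c) = (r < dist p c).
Proof. by rewrite -dist2 ltr_pXn2r // nnegrE ?dist_ge0 // ltW. Qed.

Lemma sqd_le_dist p : (sqd p c <= r ^+ 2) = (dist p c <= r).
Proof. by rewrite leNgt sqd_gt_dist -leNgt. Qed.

Lemma sqd_ge_dist p : (r ^+ 2 <= sqd p c) = (r <= dist p c).
Proof. by rewrite leNgt sqd_lt_dist -leNgt. Qed.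

Lemma circ_dist_le p : circ c' s p -> dist p c <= dist c' c + s.
Proof.
move=> /(circ_dist _ _ (ltW s0)) ps.
by have := dist_triangle p c' c; rewrite ps addrC.
Qed.

Lemma circ_dist_ge p : circ c' s p -> `|dist c' c - s| <= dist p c.
Proof.
move=> /(circ_dist _ _ (ltW s0)) ps; rewrite ler_norml.
have := dist_triangle c' p c; have := dist_triangle p c c'.
by rewrite (distC c' p) ps (distC c c'); lra.
Qed.

Lemma circ_sub_inside : circ c' s `<=` inside c r <-> dist c' c + s < r.
Proof.
split=> [h|h p /circ_dist_le pd]; last first.
  by rewrite /inside /= sqd_lt_dist; exact: le_lt_trans h.
have [u [up _] [<- _]] := circ_extremes c c' s0.
by rewrite -sqd_lt_dist; exact: h.
Qed.

Lemma circ_sub_disc : circ c' s `<=` closure (inside c r) <-> dist c' c + s <= r.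
Proof.
rewrite closure_inside //; split=> [h|h p /circ_dist_le pd]; last first.
  by rewrite /= sqd_le_dist; exact: le_trans h.
have [u [up _] [<- _]] := circ_extremes c c' s0.
by rewrite -sqd_le_dist; exact: h.
Qed.

Lemma circ_sub_outside : circ c' s `<=` outside c r <-> r < `|dist c' c - s|.
Proof.
split=> [h|h p /circ_dist_ge pd]; last first.
  by rewrite /outside /= sqd_gt_dist; exact: lt_le_trans pd.
have [u [_ up] [_ <-]] := circ_extremes c c' s0.
by rewrite -sqd_gt_dist; exact: h.
Qed.

Lemma circ_sub_exterior :
  circ c' s `<=` closure (outside c r) <-> r <= `|dist c' c - s|.
Proof.
rewrite closure_outside //; split=> [h|h p /circ_dist_ge pd]; last first.
  by rewrite /= sqd_ge_dist; exact: le_trans pd.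
have [u [_ up] [_ <-]] := circ_extremes c c' s0.
by rewrite -sqd_ge_dist; exact: h.
Qed.

Lemma gap_true_le0 : (gapc true c r c' s <= 0) = (r + s <= dist c c').
Proof.
rewrite /gapc /gap subr_le0 -dist2 ler_pXn2r // nnegrE ?dist_ge0 //.
by rewrite addr_ge0 // ltW.
Qed.

Lemma gap_true_lt0 : (gapc true c r c' s < 0) = (r + s < dist c c').
Proof.
rewrite /gapc /gap subr_lt0 -dist2 ltr_pXn2r // nnegrE ?dist_ge0 //.
by rewrite addr_ge0 // ltW.
Qed.

Lemma gap_false_ge0 : s < r -> (0 <= gapc false c r c' s) = (dist c c' + s <= r).
Proof.
move=> sr; rewrite /gapc /gap subr_ge0 -dist2 ler_pXn2r // ?nnegrE ?dist_ge0 //.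
  by rewrite lerBrDr.
by rewrite subr_ge0 ltW.
Qed.

Lemma gap_false_gt0 : s < r -> (0 < gapc false c r c' s) = (dist c c' + s < r).
Proof.
move=> sr; rewrite /gapc /gap subr_gt0 -dist2 ltr_pXn2r // ?nnegrE ?dist_ge0 //.
  by rewrite ltrBrDr.
by rewrite subr_ge0 ltW.
Qed.

End Subsets.

(** Stated by signs, not by distances, so that a table of positions can evaluate it. For distinct
    circles it is inclusion in the closed disc. *)
Definition enclosed (R : realType) (c : 'I_3 -> R * R) (r : 'I_3 -> R)
    (i j : 'I_3) : bool := (r i < r j) && (0 <= gapij c r false i j).

Definition senclosed (R : realType) (c : 'I_3 -> R * R) (r : 'I_3 -> R)
    (i j : 'I_3) : bool := (r i < r j) && (0 < gapij c r false i j).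

Definition apart (R : realType) (c : 'I_3 -> R * R) (r : 'I_3 -> R)
    (i j : 'I_3) : bool := gapij c r true i j <= 0.

Definition sapart (R : realType) (c : 'I_3 -> R * R) (r : 'I_3 -> R)
    (i j : 'I_3) : bool := gapij c r true i j < 0.

Section Separation.
Variables (R : realType) (c : 'I_3 -> R * R) (r : 'I_3 -> R).
Hypotheses (r0 : forall i, 0 < r i) (inj : injective (fun i => (c i, r i))).

Lemma enclosed_dist i j : i <> j -> enclosed c r i j <-> dist (c i) (c j) + r i <= r j.
Proof.
move=> ij; rewrite /enclosed gapijC /gapij; split=> [/andP[rij]|h].
  by rewrite gap_false_ge0 // distC.
have d0 := dist_ge0 (c i) (c j).
have rij : r i < r j.
  rewrite lt_neqAle; apply/andP; split; last by lra.
  apply/eqP => rE; apply: ij; apply: inj => /=; congr pair => //.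
  by apply: sqd_eq0; rewrite -dist2 (_ : dist _ _ = 0) ?expr0n //; lra.
by rewrite rij gap_false_ge0 //= distC.
Qed.

Lemma senclosed_dist i j : senclosed c r i j <-> dist (c i) (c j) + r i < r j.
Proof.
rewrite /senclosed gapijC /gapij; split=> [/andP[rij]|h].
  by rewrite gap_false_gt0 // distC.
have d0 := dist_ge0 (c i) (c j); have rij : r i < r j by lra.
by rewrite rij gap_false_gt0 //= distC.
Qed.

Lemma enclosed_disc i j : i <> j ->
  circles c r i `<=` closure (inside (c j) (r j)) <-> enclosed c r i j.
Proof. by move=> ij; rewrite circ_sub_disc // enclosed_dist. Qed.

Lemma senclosed_inside i j :
  circles c r i `<=` inside (c j) (r j) <-> senclosed c r i j.
Proof. by rewrite circ_sub_inside // senclosed_dist. Qed.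

(** A circle avoids an open disc either beside it or around it: these are the two signs under the
    absolute value in [circ_sub_exterior]. *)
Lemma apart_exterior i j : i <> j ->
  circles c r j `<=` closure (outside (c i) (r i)) <->
  apart c r i j || enclosed c r i j.
Proof.
move=> ij; rewrite circ_sub_exterior // /apart /gapij gap_true_le0 //.
have ri := r0 i; have d0 := dist_ge0 (c i) (c j).
rewrite (distC (c j)); split=> [|/orP[h|/(enclosed_dist ij)]]; last 2 first.
- by rewrite ger0_norm; lra.
- by move=> h; rewrite ltr0_norm; lra.
have [h|h] := ger0P (dist (c i) (c j) - r j) => h'; apply/orP.
  by left; lra.
by right; apply/(enclosed_dist ij); lra.
Qed.

Lemma sapart_outside i j :
  circles c r j `<=` outside (c i) (r i) <->
  sapart c r i j || senclosed c r i j.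
Proof.
rewrite circ_sub_outside // /sapart /gapij gap_true_lt0 //.
have ri := r0 i; have d0 := dist_ge0 (c i) (c j).
rewrite (distC (c j)); split=> [|/orP[h|/senclosed_dist]]; last 2 first.
- by rewrite ger0_norm; lra.
- by move=> h; rewrite ltr0_norm; lra.
have [h|h] := ger0P (dist (c i) (c j) - r j) => h'; apply/orP.
  by left; lra.
by right; apply/senclosed_dist; lra.
Qed.

Lemma inside_neq_outside (o : R * R) (s : R) : 0 < s -> inside o s <> outside o s.
Proof.
move=> s0 E; have : inside o s o.
  by rewrite /inside /= /sqd !subrr expr0n addr0 exprn_gt0.
move=> h; have : outside o s o by rewrite -E.
by move/(lt_trans h); rewrite ltxx.
Qed.

Lemma separatingE i : separating (circles c r) i <->
  exists j k, [/\ j <> i, k <> i & j <> k] /\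
    enclosed c r j i && (apart c r i k || enclosed c r i k).
Proof.
split=> [[j [k [[ji ki jk] [U [V [/(component_circP _ _ (r0 i)) UE]]]]]]|].
  move=> /(component_circP _ _ (r0 i)) VE UV jU kV.
  case: UE => UE; case: VE => VE; rewrite UE VE in UV jU kV => //.
    exists j, k; split=> //; apply/andP; split; first exact/(enclosed_disc ji).
    by apply/apart_exterior => // /esym.
  exists k, j; split; first by split=> // /esym.
  apply/andP; split; first exact/(enclosed_disc ki).
  by apply/apart_exterior => // /esym.
move=> [j [k [[ji ki jk] /andP[/(enclosed_disc ji) h1 h2]]]].
exists j, k; split=> //; exists (inside (c i) (r i)), (outside (c i) (r i)).
split=> //.
- by apply/component_circP => //; left.
- by apply/component_circP => //; right.
- exact: inside_neq_outside.
- by apply/apart_exterior => // /esym.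
Qed.

Lemma strictly_separatingE i : strictly_separating (circles c r) i <->
  exists j k, [/\ j <> i, k <> i & j <> k] /\
    senclosed c r j i && (sapart c r i k || senclosed c r i k).
Proof.
split=> [[j [k [[ji ki jk] [U [V [/(component_circP _ _ (r0 i)) UE]]]]]]|].
  move=> /(component_circP _ _ (r0 i)) VE UV jU kV.
  case: UE => UE; case: VE => VE; rewrite UE VE in UV jU kV => //.
    exists j, k; split=> //; apply/andP; split; first exact/senclosed_inside.
    exact/sapart_outside.
  exists k, j; split; first by split=> // /esym.
  apply/andP; split; first exact/senclosed_inside.
  exact/sapart_outside.
move=> [j [k [[ji ki jk] /andP[/senclosed_inside h1 h2]]]].
exists j, k; split=> //; exists (inside (c i) (r i)), (outside (c i) (r i)).
split=> //.
- by apply/component_circP => //; left.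
- by apply/component_circP => //; right.
- exact: inside_neq_outside.
- exact/sapart_outside.
Qed.

(** A common point of circles [i] and [k] would lie in the closed disc and in the closed exterior of
    circle [j], hence on it, and be a double point. This upgrades the weak inequalities given by the
    triangle inequality to strict ones. *)
Lemma no_meet i j k : triple_cover i j k -> ~ has_double_points (circles c r) ->
  enclosed c r i j -> apart c r j k || enclosed c r j k -> ~ tang c r i k.
Proof.
move=> [/eqP ij /eqP ik /eqP jk cov] nod eij ajk /nmeet_tang.
have [S [[uS SE] <-]] := meet_enum r0 inj ik.
case: S uS SE => [|p S] // _ SE _; apply: nod; exists p => m.
have [pi pk] : (circles c r i `&` circles c r k) p by apply/SE; rewrite mem_head.
have [->|->|->] // := cov m; apply/(circP _ _ (ltW (r0 j))).
apply/eqP; rewrite eq_le; apply/andP; split.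
  have /(enclosed_disc ij)/(_ _ pi) := eij; by rewrite closure_inside.
have /(apart_exterior jk)/(_ _ pk) := ajk; by rewrite closure_outside.
Qed.

Lemma enclosed_trans i j k : triple_cover i j k ->
  ~ has_double_points (circles c r) ->
  enclosed c r i j -> enclosed c r j k -> senclosed c r i k.
Proof.
move=> cov nod eij ejk; have [/eqP ij /eqP ik /eqP jk _] := cov.
have := no_meet cov nod eij; rewrite ejk orbT => /(_ isT).
have : enclosed c r i k.
  apply/(enclosed_dist ik); move/(enclosed_dist ij): eij; move/(enclosed_dist jk): ejk.
  by have := dist_triangle (c i) (c j) (c k); lra.
rewrite /enclosed /senclosed /tang le_eqVlt => /andP[-> /orP[/eqP <-|-> //]].
by rewrite mul0r eqxx.
Qed.

Lemma enclosed_apart i j k : triple_cover i j k ->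
  ~ has_double_points (circles c r) ->
  enclosed c r i j -> apart c r j k -> sapart c r i k.
Proof.
move=> cov nod eij ajk; have [/eqP ij /eqP ik /eqP jk _] := cov.
have := no_meet cov nod eij; rewrite ajk => /(_ isT).
have : apart c r i k.
  move: ajk; rewrite /apart /gapij !gap_true_le0 //.
  move/(enclosed_dist ij): eij.
  by have := dist_triangle (c j) (c i) (c k); rewrite (distC (c j) (c i)); lra.
rewrite /apart /sapart /tang le_eqVlt => /orP[/eqP ->|-> //].
by rewrite mulr0 eqxx.
Qed.

End Separation.

(** * Finite classification tables *)

(** Gives kinds a boolean equality, so that the tables can be evaluated. *)
Definition kind_code (k : kind) : nat :=
  match k with
  | Separated => 0 | NoTangency => 1 | OneOrTwoTangencies => 2
  | ThreeTangencies => 3 | SeparatedTangent => 4 | WithDoublePoints => 5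
  end.

Lemma kind_code_inj : injective kind_code.
Proof. by case; case. Qed.

Definition kinds : seq kind :=
  [:: Separated; NoTangency; OneOrTwoTangencies; ThreeTangencies;
      SeparatedTangent; WithDoublePoints].

Definition selects (kb : kind -> bool) (n : nat) (x : apollonius_case) : bool :=
  kb (case_kind x) && (case_n x == n).

(** The conjuncts match the three clauses of the classification. The first two together make the
    kinds mutually exclusive: two kinds that hold would need two different rows. *)
Definition classified (kb : kind -> bool) (n : nat) (N : option nat) : bool :=
  [&& count (selects kb n) apollonius_cases == 1%N,
      all (fun k => kb k ==> has (fun x => selects kb n x &&
        (kind_code (case_kind x) == kind_code k)) apollonius_cases) kinds &
      all (fun x => selects kb n x ==> (case_N x == N)) apollonius_cases].

Lemma count1_exists_unique (T : Type) (n : nat) (t : n.-tuple T) (P : pred T) :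
  count P t = 1%N -> exists! i, P (tnth t i).
Proof.
rewrite -sum1_count big_tuple sum1dep_card => /eqP/cards1P[i E].
exists i; split; first by have := set11 i; rewrite -E inE.
by move=> j Pj; apply/esym/set1P; rewrite -E inE.
Qed.

Lemma classified_cases (R : realType) (C : 'I_3 -> set (R * R))
    (kb : kind -> bool) (n : nat) (N : option nat) :
  (forall k, of_kind C k <-> kb k) ->
  (intersection_points C #= `I_n)%card -> has_number (solutions C) N ->
  classified kb n N ->
  [/\ exists! i : 'I_17, falls_into C (tnth apollonius_cases i),
      forall k : kind, of_kind C k ->
        exists i : 'I_17, case_kind (tnth apollonius_cases i) = k /\
          falls_into C (tnth apollonius_cases i)
    & forall i : 'I_17, falls_into C (tnth apollonius_cases i) ->
        has_number (solutions C) (case_N (tnth apollonius_cases i))].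
Proof.
move=> kP nP NP /and3P[/eqP c1 ak aN].
have fP x : falls_into C x <-> selects kb n x.
  rewrite /falls_into /selects kP; split=> [[-> /=]|/andP[-> /eqP ->] //].
  move=> h; apply/eqP/card_eq_II; apply: card_eq_trans nP.
  by rewrite card_eq_sym.
split.
- have [i [iP iU]] := count1_exists_unique c1.
  by exists i; split=> [|j /fP/iU //]; apply/fP.
- move=> k /kP kbk.
  have : has (fun x => selects kb n x && (kind_code (case_kind x) == kind_code k))
      apollonius_cases.
    move: ak kbk; case: (k) => /and5P[h0 h1 h2 h3 /and3P[h4 h5 _]];
      exact/implyP.
  move=> /(has_nthP (thead apollonius_cases))[i]; rewrite size_tuple => ilt.
  rewrite -[i]/(nat_of_ord (Ordinal ilt)) -tnth_nth => /andP[s /eqP/kind_code_inj e].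
  by exists (Ordinal ilt); split=> //; apply/fP.
- move=> i /fP s; have := all_tnthP aN i; rewrite s /= => /eqP ->; exact: NP.
Qed.

(* [InTouch]: the first circle lies in the disc of the second and touches it;
   [AroundTouch] is the converse position. *)
Inductive position : Type :=
  Apart | OutTouch | Crossing | InTouch | In | AroundTouch | Around.

(* The signs of the two gaps, [true] being the external one. *)
Definition pgap (b : bool) (p : position) : int :=
  match p with
  | Apart => -1
  | OutTouch => if b then 0 else -1
  | Crossing => if b then 1 else -1
  | InTouch | AroundTouch => if b then 1 else 0
  | In | Around => 1
  end.

Definition pswap (p : position) : position :=
  match p with
  | InTouch => AroundTouch | In => Around
  | AroundTouch => InTouch | Around => In
  | _ => p
  end.

Definition pencl (p : position) : bool :=
  match p with InTouch | In => true | _ => false end.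
Definition psencl (p : position) : bool :=
  match p with In => true | _ => false end.
Definition papart (p : position) : bool :=
  match p with Apart | OutTouch => true | _ => false end.
Definition psapart (p : position) : bool :=
  match p with Apart => true | _ => false end.
Definition ptang (p : position) : bool :=
  match p with OutTouch | InTouch | AroundTouch => true | _ => false end.
Definition pmeet (p : position) : nat :=
  match p with Crossing => 2 | Apart | In | Around => 0 | _ => 1 end.

Definition inroots (s : int) : nat := (s <= 0)%R + (s < 0)%R.

Lemma nroots_sg (R : realType) (x : R) : nroots (- x) = inroots (sgz x).
Proof. by rewrite /nroots /inroots oppr_ge0 oppr_gt0 sgz_le0 sgz_lt0. Qed.

Section Position.
Variables (R : realType) (c : 'I_3 -> R * R) (r : 'I_3 -> R).
Hypotheses (r0 : forall i, 0 < r i) (inj : injective (fun i => (c i, r i))).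

(** The internal gap is always below the external one, so the signs leave five cases. In the two
    with nonnegative internal gap the radii of distinct circles differ and tell which circle is the
    inner one. *)
Definition pos (i j : 'I_3) : position :=
  if gapij c r true i j < 0 then Apart
  else if gapij c r true i j == 0 then OutTouch
  else if gapij c r false i j < 0 then Crossing
  else if r i < r j then if gapij c r false i j == 0 then InTouch else In
  else if gapij c r false i j == 0 then AroundTouch else Around.

Lemma gap_lt i j : gapij c r false i j < gapij c r true i j.
Proof.
have : 0 < r i * r j by rewrite mulr_gt0.
by rewrite /gapij /gapc /gap; nra.
Qed.

Lemma radius_neq i j : i <> j -> 0 <= gapij c r false i j -> r i != r j.
Proof.
move=> ij; rewrite /gapij /gapc /gap; apply: contraTneq => rE.
rewrite rE subrr expr0n /= add0r oppr_ge0 -ltNge lt_neqAle sqd_ge0 andbT eq_sym.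
by apply/eqP => /sqd_eq0 cE; apply: ij; apply: inj => /=; rewrite rE cE.
Qed.

Lemma posP i j : i <> j ->
  (forall b, sgz (gapij c r b i j) = pgap b (pos i j)) /\
  [/\ enclosed c r i j = pencl (pos i j), senclosed c r i j = psencl (pos i j),
      apart c r i j = papart (pos i j), sapart c r i j = psapart (pos i j) &
      pos j i = pswap (pos i j)].
Proof.
move=> ij; have lt := gap_lt i j; have rn := radius_neq ij.
rewrite /enclosed /senclosed /apart /sapart /pos !(gapijC _ _ _ j).
have sgE b : sgz (gapij c r b i j) =
    if gapij c r b i j < 0 then -1 else if gapij c r b i j == 0 then 0 else 1.
  by case: (ltgtP (gapij c r b i j) 0) => h;
    rewrite ?(ltr0_sgz h) ?(gtr0_sgz h) // h sgz0.
split=> [b|]; rewrite ?sgE; move: lt rn; clear ij.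
  by case: b; case: (ltgtP (gapij c r true i j) 0) => ht;
    case: (ltgtP (gapij c r false i j) 0) => hf;
    case: (ltgtP (r i) (r j)) => hr //= lt rn; exfalso;
    rewrite ?ht ?hf in lt rn *; try lra; by move: (rn isT).
case: (ltgtP (gapij c r true i j) 0) => ht;
  case: (ltgtP (gapij c r false i j) 0) => hf;
  case: (ltgtP (r i) (r j)) => hr //= lt rn; exfalso;
  rewrite ?ht ?hf in lt rn *; try lra; by move: (rn isT).
Qed.

End Position.

Section PositionTable.
Variables p q s : position.

(** The default [Apart] on the diagonal is never consulted, since the triples in [orders] have
    distinct entries. *)
Definition table (a b : nat) : position :=
  match a, b with
  | 0, 1 => p | 0, 2 => q | 1, 2 => s
  | 1, 0 => pswap p | 2, 0 => pswap q | 2, 1 => pswap s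
  | _, _ => Apart
  end%N.

Definition orders : seq (nat * nat * nat) :=
  [:: (0, 1, 2); (0, 2, 1); (1, 0, 2); (1, 2, 0); (2, 0, 1); (2, 1, 0)]%N.

Definition pseparating : bool :=
  has (fun t => pencl (table t.1.2 t.1.1) &&
    (papart (table t.1.1 t.2) || pencl (table t.1.1 t.2))) orders.

Definition pstrictly_separating : bool :=
  has (fun t => psencl (table t.1.2 t.1.1) &&
    (psapart (table t.1.1 t.2) || psencl (table t.1.1 t.2))) orders.

Definition pcoherent : bool :=
  all (fun t => pencl (table t.1.1 t.1.2) ==>
    ((pencl (table t.1.2 t.2) ==> psencl (table t.1.1 t.2)) &&
     (papart (table t.1.2 t.2) ==> psapart (table t.1.1 t.2)))) orders.

Definition ptangencies : nat := ptang p + ptang q + ptang s.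

Definition pintersections : nat := pmeet p + pmeet q + pmeet s.

Definition psolutions : nat :=
  let f b b' := inroots (pgap b p * pgap b' q * pgap (b (+) b') s) in
  f false false + f false true + f true false + f true true.

Definition pkind (k : kind) : bool :=
  match k with
  | Separated => pstrictly_separating
  | NoTangency => (ptangencies == 0%N) && ~~ pstrictly_separating
  | OneOrTwoTangencies =>
      ((ptangencies == 1%N) || (ptangencies == 2%N)) && ~~ pseparating
  | ThreeTangencies => ptangencies == 3%N
  | SeparatedTangent => (ptangencies != 0%N) && pseparating
  | WithDoublePoints => false
  end.

End PositionTable.

(** Evaluation over all 343 triples of positions. Coherence is the only geometric input; whether a
    coherent triple is realized by circles does not matter. *)
Lemma pclassified p q s : pcoherent p q s ->
  classified (pkind p q s) (pintersections p q s) (Some (psolutions p q s)).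
Proof. by apply/implyP; move: p q s; do 3!case; vm_compute. Qed.


Definition o0 : 'I_3 := @Ordinal 3 0 isT.
Definition o1 : 'I_3 := @Ordinal 3 1 isT.
Definition o2 : 'I_3 := @Ordinal 3 2 isT.

Lemma cover012 : triple_cover o0 o1 o2.
Proof. exact: triple_coverP. Qed.

Lemma ordersP (i j k : 'I_3) : i <> j -> i <> k -> j <> k ->
  (val i, val j, val k) \in orders.
Proof.
move=> /eqP ij /eqP ik /eqP jk.
have [_ _ _ cov] := cover012.
by move: ij ik jk; have [->|->|->] := cov i; have [->|->|->] := cov j;
  have [->|->|->] := cov k.
Qed.

Lemma ordersW (Q : 'I_3 -> 'I_3 -> 'I_3 -> Prop) t :
  (forall i j k, i <> j -> i <> k -> j <> k -> Q i j k) -> t \in orders ->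
  exists i j k, [/\ t = (val i, val j, val k),
    [/\ i <> j, i <> k & j <> k] & Q i j k].
Proof.
move=> QP; rewrite !inE.
case/or4P => [/eqP ->|/eqP ->|/eqP ->|/or3P[/eqP ->|/eqP ->|/eqP ->]].
- by exists o0, o1, o2; split=> //; exact: QP.
- by exists o0, o2, o1; split=> //; exact: QP.
- by exists o1, o0, o2; split=> //; exact: QP.
- by exists o1, o2, o0; split=> //; exact: QP.
- by exists o2, o0, o1; split=> //; exact: QP.
- by exists o2, o1, o0; split=> //; exact: QP.
Qed.

Section NoDoublePoint.
Variables (R : realType) (c : 'I_3 -> R * R) (r : 'I_3 -> R).
Hypotheses (r0 : forall i, 0 < r i) (inj : injective (fun i => (c i, r i))).
Hypothesis nod : ~ has_double_points (circles c r).

Let p := pos c r o0 o1.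
Let q := pos c r o0 o2.
Let s := pos c r o1 o2.

Lemma tableP i j : i <> j -> table p q s (val i) (val j) = pos c r i j.
Proof.
move=> ij; have sw a b : a <> b -> pos c r b a = pswap (pos c r a b).
  by move=> ab; have [_ []] := posP r0 inj ab.
have [_ _ _ cov] := cover012; move: ij.
by have [->|->|->] := cov i; have [->|->|->] := cov j => ij //=; rewrite sw.
Qed.

Lemma table_encl i j : i <> j ->
  [/\ pencl (table p q s (val i) (val j)) = enclosed c r i j,
      psencl (table p q s (val i) (val j)) = senclosed c r i j,
      papart (table p q s (val i) (val j)) = apart c r i j &
      psapart (table p q s (val i) (val j)) = sapart c r i j].
Proof. by move=> ij; rewrite tableP //; have [_ []] := posP r0 inj ij. Qed.

Lemma table_coherent : pcoherent p q s.
Proof.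
apply/allP => t; pose Q i j k := triple_cover i j k.
have QP i j k : i <> j -> i <> k -> j <> k -> Q i j k.
  by move=> /eqP ij /eqP ik /eqP jk; exact: triple_coverP.
move=> /(ordersW QP)[i [j [k [-> [ij ik jk] cov]]]] /=.
have [-> _ _ _] := table_encl ij; have [-> _ -> _] := table_encl jk.
have [_ -> _ ->] := table_encl ik.
apply/implyP => h; apply/andP; split; apply/implyP => h'.
  exact: (enclosed_trans r0 inj cov nod h h').
exact: (enclosed_apart r0 inj cov nod h h').
Qed.

Lemma table_separating :
  (exists i, separating (circles c r) i) <-> pseparating p q s.
Proof.
split=> [[i /(separatingE r0 inj)[j [k [[ji ki jk] h]]]]|/hasP[t]].
  apply/hasP; exists (val i, val j, val k) => /=.
    by apply: ordersP => //; exact: nesym.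
  have [-> _ _ _] := table_encl ji.
  by have [-> _ -> _] := table_encl (nesym ki).
move=> /(@ordersW (fun _ _ _ => True))[//|i [j [k [-> [ij ik jk] _]]]] /= h.
exists i; apply/(separatingE r0 inj); exists j, k; split.
  by split=> //; exact: nesym.
move: h; have [-> _ _ _] := table_encl (nesym ij).
by have [-> _ -> _] := table_encl ik.
Qed.

Lemma table_strictly_separating :
  (exists i, strictly_separating (circles c r) i) <->
  pstrictly_separating p q s.
Proof.
split=> [[i /(strictly_separatingE c r0)[j [k [[ji ki jk] h]]]]|/hasP[t]].
  apply/hasP; exists (val i, val j, val k) => /=.
    by apply: ordersP => //; exact: nesym.
  have [_ -> _ _] := table_encl ji.
  by have [_ -> _ ->] := table_encl (nesym ki).
move=> /(@ordersW (fun _ _ _ => True))[//|i [j [k [-> [ij ik jk] _]]]] /= h.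
exists i; apply/(strictly_separatingE c r0); exists j, k; split.
  by split=> //; exact: nesym.
move: h; have [_ -> _ _] := table_encl (nesym ij).
by have [_ -> _ ->] := table_encl ik.
Qed.

Lemma pos_tang i j : i <> j -> tang c r i j = ptang (pos c r i j).
Proof.
move=> ij; have [g _] := posP r0 inj ij.
by rewrite /tang -sgz_eq0 sgzM !g; case: (pos c r i j).
Qed.

Lemma pos_nmeet i j : i <> j -> nmeet c r i j = pmeet (pos c r i j).
Proof.
move=> ij; have [g _] := posP r0 inj ij.
by rewrite /nmeet nroots_sg sgzM !g; case: (pos c r i j).
Qed.

Lemma table_kind k : of_kind (circles c r) k <-> pkind p q s k.
Proof.
have [_ tE] := meets_no_double r0 inj cover012 nod.
rewrite !pos_tang // -/p -/q -/s -/(ptangencies p q s) in tE.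
have tP n : (tangency_points (circles c r) #= `I_n)%card <->
    ptangencies p q s == n.
  split=> [h|/eqP <- //]; apply/eqP/card_eq_II.
  by apply: card_eq_trans h; rewrite card_eq_sym.
have hT : has_tangent_circles (circles c r) <-> ptangencies p q s != 0%N.
  rewrite (has_tangent_circlesE c r0 cover012) !pos_tang // -/p -/q -/s.
  by rewrite /ptangencies; case: (ptang p); case: (ptang q); case: (ptang s).
have hS := propext table_separating; have hSS := propext table_strictly_separating.
have {}hT := propext hT; have {}tP n := propext (tP n).
case: k => /=.
- by rewrite hSS.
- rewrite hT hSS; split; first by move=> [/negP + _ /negP ->]; rewrite negbK => ->.
  by move=> /andP[t0 /negP ?]; split=> //; rewrite t0.
- rewrite !tP hS; split=> [[/orP -> /negP -> _] //|].
  by move=> /andP[/orP ? /negP ?].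
- by rewrite tP.
- by rewrite hT hS; split=> [[-> -> _]|/andP[-> ->]].
- by [].
Qed.

Lemma nsol_table b b' : nsol c r o0 o1 o2 b b' =
  inroots (pgap b p * pgap b' q * pgap (b (+) b') s).
Proof.
have gE i j (ij : i <> j) := (posP r0 inj ij).1.
by rewrite /nsol nroots_sg !sgzM !gE.
Qed.

Lemma classified_no_double :
  [/\ exists! i : 'I_17, falls_into (circles c r) (tnth apollonius_cases i),
      forall k : kind, of_kind (circles c r) k ->
        exists i : 'I_17, case_kind (tnth apollonius_cases i) = k /\
          falls_into (circles c r) (tnth apollonius_cases i)
    & forall i : 'I_17, falls_into (circles c r) (tnth apollonius_cases i) ->
        has_number (solutions (circles c r))
          (case_N (tnth apollonius_cases i))].
Proof.
apply: (classified_cases table_kind _ _ (pclassified table_coherent)).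
  have [] := meets_no_double r0 inj cover012 nod.
  by rewrite !pos_nmeet.
have := solutions_no_double r0 inj cover012 nod.
by rewrite !nsol_table.
Qed.

End NoDoublePoint.

(** * Configurations with a double point *)

Section DoublePoint.
Variables (R : realType) (c : 'I_3 -> R * R) (r : 'I_3 -> R).
Hypotheses (r0 : forall i, 0 < r i) (inj : injective (fun i => (c i, r i))).
Variable p : R * R.
Hypothesis dp : double_points (circles c r) p.

Let area (i j : 'I_3) : R :=
  ((c i).1 - p.1) * ((c j).2 - p.2) - ((c i).2 - p.2) * ((c j).1 - p.1).

Lemma gap_area i j :
  gapij c r false i j * gapij c r true i j = - (2 * area i j) ^+ 2.
Proof.
have pE m : r m ^+ 2 = ((c m).1 - p.1) ^+ 2 + ((c m).2 - p.2) ^+ 2.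
  by have /(circP _ _ (ltW (r0 m))) <- := dp m; rewrite sqdC.
have -> : gapij c r false i j * gapij c r true i j =
    (r i ^+ 2 + r j ^+ 2 - sqd (c i) (c j)) ^+ 2 - 4 * r i ^+ 2 * r j ^+ 2.
  by rewrite /gapij /gapc /gap; ring.
by rewrite !pE /area /sqd; ring.
Qed.

Lemma tang_area i j : tang c r i j = (area i j == 0).
Proof. by rewrite /tang gap_area oppr_eq0 sqrf_eq0 mulf_eq0 pnatr_eq0. Qed.

(** Tangency at [p] is collinearity of the centers with [p]; it passes through circle [i] because
    the positive radius keeps its center away from [p]. *)
Lemma tang_trans i j k : tang c r i j -> tang c r i k -> tang c r j k.
Proof.
rewrite !tang_area => /eqP ij /eqP ik.
have : r i ^+ 2 != 0 by rewrite sqrf_eq0 lt0r_neq0.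
have /(circP _ _ (ltW (r0 i))) <- := dp i.
move=> pi; rewrite -(inj_eq (mulfI pi)) mulr0; apply/eqP.
transitivity (((c i).1 - p.1) * ((c j).1 - p.1) * area i k
  + ((c i).2 - p.2) * ((c j).2 - p.2) * area i k
  - ((c i).1 - p.1) * ((c k).1 - p.1) * area i j
  - ((c i).2 - p.2) * ((c k).2 - p.2) * area i j).
  by rewrite /sqd /area; ring.
by rewrite ij ik !mulr0 addr0 !subr0.
Qed.

Lemma nmeet_double i j : nmeet c r i j = if tang c r i j then 1%N else 2%N.
Proof.
case: ifP => [/nmeet_tang //|]; rewrite tang_area /nmeet gap_area opprK => a0.
have h : 0 < (2 * area i j) ^+ 2.
  by rewrite lt_neqAle sqr_ge0 andbT eq_sym sqrf_eq0 mulf_eq0 pnatr_eq0 a0.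
by rewrite /nroots h ltW.
Qed.

Lemma tang_meet i j : i <> j -> tang c r i j ->
  circles c r i `&` circles c r j = [set p].
Proof.
move=> ij t; have [S [[_ SE]]] := meet_enum r0 inj ij.
rewrite nmeet_double t; case: S SE => [|q []] // SE _.
have /SE : (circles c r i `&` circles c r j) p by split; exact: dp.
rewrite inE => /eqP ->; apply/seteqP; split=> x /=.
  by move/SE; rewrite inE => /eqP.
by move=> ->; apply/SE; rewrite mem_head.
Qed.

Lemma cross_meet i j : i <> j -> ~~ tang c r i j ->
  exists2 q, q <> p & circles c r i `&` circles c r j = [set p; q].
Proof.
move=> ij /negbTE t; have [S [[uS SE]]] := meet_enum r0 inj ij.
rewrite nmeet_double t; case: S uS SE => [|a [|b []]] //= /andP[+ _] SE _.
rewrite inE => /eqP ab.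
have /SE : (circles c r i `&` circles c r j) p by split; exact: dp.
rewrite !inE => /orP[/eqP pE|/eqP pE].
  exists b; first by rewrite pE => /esym.
  apply/seteqP; split=> x /=; first by move/SE; rewrite !inE pE => /orP[/eqP|/eqP]; [left|right].
  by rewrite pE => -[] ->; apply/SE; rewrite !inE eqxx ?orbT.
exists a; first by rewrite pE.
apply/seteqP; split=> x /=; first by move/SE; rewrite !inE pE => /orP[/eqP|/eqP]; [right|left].
by rewrite pE => -[] ->; apply/SE; rewrite !inE eqxx ?orbT.
Qed.

(** Strict separation fails because [p] lies on the separating circle and on the one inside it;
    three tangency points fail because every tangent pair meets only in [p]. *)
Lemma double_kind k : of_kind (circles c r) k <-> kind_code k == 5%N.
Proof.
have hd : has_double_points (circles c r) by exists p.
case: k => /=; split=> //; try by case.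
- case=> i /(strictly_separatingE c r0)[j [k [_ /andP[+ _]]]].
  move=> /(senclosed_inside c r0)/(_ p (dp j)); rewrite /inside /=.
  by have /(circP _ _ (ltW (r0 i))) -> := dp i; rewrite ltxx.
- move=> h; have : (tangency_points (circles c r) #<= [set p])%card.
    apply: subset_card_le => x; rewrite (tangency_pointsE c r0 cover012) /=.
    have tm m n : m <> n -> tang c r m n /\ circles c r m x /\ circles c r n x ->
        x = p.
      move=> mn [t mnx]; have : (circles c r m `&` circles c r n) x by [].
      by rewrite tang_meet.
    by case=> [[]|]; exact: tm.
  by rewrite (card_le_eql h) (card_le_eqr card_set1) card_le_II.
Qed.

Let classified_double (n : nat) (N : option nat) : Prop :=
  (intersection_points (circles c r) #= `I_n)%card /\
  has_number (solutions (circles c r)) N.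

Lemma classified_doubleP (n : nat) (N : option nat) :
  classified (fun k => kind_code k == 5%N) n N -> classified_double n N ->
  [/\ exists! i : 'I_17, falls_into (circles c r) (tnth apollonius_cases i),
      forall k : kind, of_kind (circles c r) k ->
        exists i : 'I_17, case_kind (tnth apollonius_cases i) = k /\
          falls_into (circles c r) (tnth apollonius_cases i)
    & forall i : 'I_17, falls_into (circles c r) (tnth apollonius_cases i) ->
        has_number (solutions (circles c r))
          (case_N (tnth apollonius_cases i))].
Proof. by move=> h [h1 h2]; exact: classified_cases double_kind h1 h2 h. Qed.

Lemma double_three_tangencies i j k : triple_cover i j k ->
  tang c r i j -> tang c r i k -> classified_double 1 None.
Proof.
move=> cov ij ik; have jk := tang_trans ij ik.
have [/eqP nij /eqP nik /eqP njk _] := cov; split.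
  rewrite (intersection_pointsE _ cov) !tang_meet // !setUid.
  exact: card_set1.
have zero m l : tang c r m l -> exists b, gapij c r b m l = 0.
  by rewrite /tang mulf_eq0 => /orP[/eqP ?|/eqP ?]; [exists false|exists true].
have [b bE] := zero _ _ ij; have [b' b'E] := zero _ _ ik.
apply: (@solutions_infinite _ c r i j k b b' r0 cov).
have := (common3P c p r0 cov).1 dp => h.
apply: (contact_infinite (r0 i) h).
  by move: bE; rewrite /gapij /gapc sqdC.
by move: b'E; rewrite /gapij /gapc sqdC.
Qed.

(** Parallel normals mean coaxial circles. Used contrapositively: a point that lies on just two of
    the circles proves the normals independent. *)
Lemma parallel_common i j k q : triple_cover i j k ->
  cross3 (relvec (c i) (r i) (c j) (r j)) (relvec (c i) (r i) (c k) (r k)) = 0 ->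
  circles c r i q -> circles c r j q -> circles c r k q.
Proof.
move=> [/eqP ij _ _ _] w0.
have cP m : circles c r m q <-> sqd q (c m) = r m ^+ 2.
  exact: circP (ltW (r0 m)).
have n0 : relvec (c i) (r i) (c j) (r j) <> 0.
  by apply: nvec_neq0 => //; apply: rel_neq0 => /inj/esym.
have [l lE] := parallel3 n0 w0.
move=> /cP qi; have qi' : (q.1 - (c i).1) ^+ 2 + (q.2 - (c i).2) ^+ 2 = r i ^+ 2 by [].
have lp m : circles c r m q <->
    dot3 (relvec (c i) (r i) (c m) (r m)) (- r i, q.1 - (c i).1, q.2 - (c i).2) = 0.
  rewrite cP -(light_point _ _ _ (r0 i) qi') !opprB !addrA !subrK.
  by [].
move=> /lp h; apply/lp; rewrite lE.
transitivity (l * dot3 (relvec (c i) (r i) (c j) (r j))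
  (- r i, q.1 - (c i).1, q.2 - (c i).2)); last by rewrite h mulr0.
by rewrite /dot3 /lin3 /=; ring.
Qed.

Lemma cross3C (n m : R * R * R) : cross3 n m = 0 -> cross3 m n = 0.
Proof.
case=> e1 e2 e3; apply: triple_eq => /=; apply/eqP; rewrite subr_eq0 eq_sym;
  rewrite -subr_eq0; apply/eqP; [rewrite -[RHS]e1|rewrite -[RHS]e2|rewrite -[RHS]e3];
  rewrite /=; ring.
Qed.

Lemma nonpoint_double i j k b b' : triple_cover i j k ->
  cross3 (relvec (c i) (r i) (c j) (r j)) (relvec (c i) (r i) (c k) (r k)) <> 0 ->
  ~~ (tang c r i j && tang c r i k) ->
  exists S, enumerates S (nonpoint c r i j k b b') /\
    size S = (gapij c r b i j * gapij c r b' i k * gapij c r (b (+) b') j k != 0)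
    :> nat.
Proof.
move=> cov w0 t; rewrite -gap3E.
apply: (contact_one_common (r0 i) ((common3P c p r0 cov).1 dp) w0) => -[g h].
have z m a : gap a (r i) (r m) (((c m).1 - (c i).1) ^+ 2 + ((c m).2 - (c i).2) ^+ 2) = 0 ->
    tang c r i m.
  rewrite -[_ + _]/(sqd (c m) (c i)) sqdC => e; rewrite /tang mulf_eq0 /gapij /gapc.
  by case: a e => ->; rewrite eqxx ?orbT.
by move/negP: t; apply; rewrite (z j b g) (z k b' h).
Qed.

Let gaps_neq0 (i j k : 'I_3) (b b' : bool) : nat :=
  gapij c r b i j * gapij c r b' i k * gapij c r (b (+) b') j k != 0.

Lemma solutions_one_double i j k : triple_cover i j k ->
  cross3 (relvec (c i) (r i) (c j) (r j)) (relvec (c i) (r i) (c k) (r k)) <> 0 ->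
  ~~ (tang c r i j && tang c r i k) ->
  double_points (circles c r) = [set p] ->
  (solutions (circles c r) #= `I_(gaps_neq0 i j k false false +
    gaps_neq0 i j k false true + gaps_neq0 i j k true false +
    gaps_neq0 i j k true true + 1))%card.
Proof.
move=> cov w0 t dE; pose f := gaps_neq0 i j k.
have /choice[S SE] : forall bb : bool * bool, exists S,
    enumerates S (nonpoint c r i j k bb.1 bb.2) /\ size S = f bb.1 bb.2.
  by move=> [b b']; exact: nonpoint_double.
have := @solutions_enum _ c r i j k (fun b b' => S (b, b')) [:: p] r0 cov.
rewrite !(SE _).2 /=; apply=> [b b'|]; first exact: (SE (b, b')).1.
by rewrite dE; split=> // x; rewrite inE; split=> [->|/eqP].
Qed.

(** Exactly one gap of the tangent pair vanishes, which removes two of the four orientation pairs;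
    the other two give one object each, and [p] itself is the third solution. *)
Lemma double_one_tangency i j k : triple_cover i j k ->
  tang c r i j -> ~~ tang c r i k -> classified_double 3 (Some 3%N).
Proof.
move=> cov ij ik; have [/eqP nij /eqP nik /eqP njk covm] := cov.
have jk : ~~ tang c r j k.
  by apply: contraNN ik => jk; apply: tang_trans jk; rewrite tangC.
have Eij := tang_meet nij ij.
have [q qp Eik] := cross_meet nik ik; have [q' q'p Ejk] := cross_meet njk jk.
have onij x : circles c r i x -> circles c r j x -> x = p.
  move=> hi hj; have : (circles c r i `&` circles c r j) x by [].
  by rewrite Eij.
have [qi qk] : (circles c r i `&` circles c r k) q by rewrite Eik; right.
have [q'j q'k] : (circles c r j `&` circles c r k) q' by rewrite Ejk; right.
have qq' : q <> q' by move=> e; apply: qp; apply: onij => //; rewrite e.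
have dE : double_points (circles c r) = [set p].
  apply/seteqP; split=> x; last by move=> ->.
  by move=> h; apply: onij.
split.
  rewrite (intersection_pointsE _ cov) Eij Eik Ejk.
  apply: (@enumerates_card _ [:: p; q; q']); split.
    by rewrite /= !inE negb_or !andbT -!(rwP andP);
      split; [split|]; apply/eqP => // /esym.
  move=> x; rewrite !inE /=; split.
    by case=> [[->|[->|->]]|[->|->]]; rewrite !eqxx ?orbT.
  by case/or3P => /eqP ->; [left; left|left; right; right|right; right].
rewrite /has_number.
have w0 : cross3 (relvec (c i) (r i) (c j) (r j))
    (relvec (c i) (r i) (c k) (r k)) <> 0.
  move=> /cross3C w0; apply: qp; apply: onij => //.
  have cov' : triple_cover i k j by apply: triple_coverP; apply/eqP => // /esym.
  exact: (parallel_common cov' w0).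
have := solutions_one_double cov w0 _ dE; rewrite (negbTE ik) andbF => /(_ isT).
rewrite /gaps_neq0 /=; congr (is_true (_ #= `I_ _)%card).
have nz m l : ~~ tang c r m l -> forall b, (gapij c r b m l == 0) = false.
  by rewrite /tang mulf_eq0 negb_or => /andP[/negbTE h /negbTE h'] [].
rewrite !mulf_eq0 !(nz _ _ ik) !(nz _ _ jk) !orbF.
move: ij; rewrite /tang mulf_eq0; have := gap_lt c r0 i j.
case: eqP => [->|_]; first by move/gt_eqF => ->.
by move=> _ /= ->.
Qed.

(** No gap vanishes, so each of the four orientation pairs gives one object, and [p] is the fifth
    solution. *)
Lemma double_four_points i j k : triple_cover i j k ->
  (forall q, double_points (circles c r) q -> q = p) ->
  ~~ tang c r i j -> ~~ tang c r i k -> ~~ tang c r j k ->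
  classified_double 4 (Some 5%N).
Proof.
move=> cov dU ij ik jk; have [/eqP nij /eqP nik /eqP njk covm] := cov.
have all3 x : circles c r i x -> circles c r j x -> circles c r k x -> x = p.
  by move=> hi hj hk; apply: dU => m; have [->|->|->] := covm m.
have [q qp Eij] := cross_meet nij ij.
have [q' q'p Eik] := cross_meet nik ik.
have [q'' q''p Ejk] := cross_meet njk jk.
have [qi qj] : (circles c r i `&` circles c r j) q by rewrite Eij; right.
have [q'i q'k] : (circles c r i `&` circles c r k) q' by rewrite Eik; right.
have [q''j q''k] : (circles c r j `&` circles c r k) q'' by rewrite Ejk; right.
have e1 : q <> q' by move=> e; apply: qp; apply: all3 => //; rewrite e.
have e2 : q <> q'' by move=> e; apply: qp; apply: all3 => //; rewrite e.
have e3 : q' <> q'' by move=> e; apply: q'p; apply: all3 => //; rewrite e.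
have dE : double_points (circles c r) = [set p].
  by apply/seteqP; split=> x; [exact: dU|move=> ->].
split.
  rewrite (intersection_pointsE _ cov) Eij Eik Ejk.
  apply: (@enumerates_card _ [:: p; q; q'; q'']); split.
    rewrite /= !inE !negb_or !andbT.
    by apply/and3P; split; [apply/and3P; split|apply/andP; split|];
      apply/eqP => // /esym.
  move=> x; rewrite !inE /=; split.
    by case=> [[[->|->]|[->|->]]|[->|->]]; rewrite !eqxx ?orbT.
  by case/or4P => /eqP ->; [do 2 left; left|do 2 left; right|left; right; right
    |right; right].
have w0 : cross3 (relvec (c i) (r i) (c j) (r j))
    (relvec (c i) (r i) (c k) (r k)) <> 0.
  move=> w0; apply: qp; apply: all3 => //.
  exact: (parallel_common cov w0).
have := solutions_one_double cov w0 _ dE; rewrite (negbTE ik) andbF => /(_ isT).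
rewrite /has_number /gaps_neq0 /=.
have nz m l : ~~ tang c r m l -> forall b, (gapij c r b m l == 0) = false.
  by rewrite /tang mulf_eq0 negb_or => /andP[/negbTE h /negbTE h'] [].
by rewrite !mulf_eq0 !(nz _ _ ik) !(nz _ _ jk) !(nz _ _ ij).
Qed.

(** The circles form a pencil through [p] and [q] without tangencies, so all contact equations are
    inconsistent and only the two points remain. *)
Lemma double_two_points i j k q : triple_cover i j k -> q <> p ->
  double_points (circles c r) q -> classified_double 2 (Some 2%N).
Proof.
move=> cov qp dq; have [/eqP nij /eqP nik /eqP njk covm] := cov.
have nt m l : m <> l -> ~~ tang c r m l.
  move=> ml; apply/negP => /(tang_meet ml) E; apply: qp.
  have : (circles c r m `&` circles c r l) q by split; exact: dq.
  by rewrite E.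
have E m l : m <> l -> circles c r m `&` circles c r l = [set p; q].
  move=> ml; have [x xp e] := cross_meet ml (nt _ _ ml).
  have : (circles c r m `&` circles c r l) q by split; exact: dq.
  by rewrite e => -[//|/= ->].
have PE A : A = [set p; q] -> enumerates [:: p; q] A.
  move=> ->; split; first by rewrite /= inE andbT; apply/eqP => /esym.
  move=> x; rewrite !inE /=; split=> [[|] ->|/orP[/eqP|/eqP] ->]; rewrite ?eqxx ?orbT //.
    by left.
  by right.
split.
  rewrite (intersection_pointsE _ cov) !E // !setUid.
  exact: enumerates_card (PE _ erefl).
have w0 : cross3 (relvec (c i) (r i) (c j) (r j))
    (relvec (c i) (r i) (c k) (r k)) = 0.
  (* Both double points give lightlike vectors annihilated by the two normals. Were the normals
     independent, both vectors would be multiples of [w], and equal because their first coordinates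
     are. *)
  apply: contrapT => w0.
  set w := cross3 _ _ in w0.
  have on x : double_points (circles c r) x ->
      exists l, (- r i, x.1 - (c i).1, x.2 - (c i).2) = lin3 l w 0 w.
    move=> /(common3P c x r0 cov)[xi xj xk]; apply: parallel3 w0 _.
    apply/cross3C/light_cross.
      exact/(light_point _ _ _ (r0 i) xi).
    exact/(light_point _ _ _ (r0 i) xi).
  clearbody w; have [l [e1 e2 e3]] := on _ dp.
  have [l' [e1' e2' e3']] := on _ dq.
  have ri := lt0r_neq0 (r0 i).
  have w1 : w.1.1 != 0.
    by apply: contra_neq ri => w1; apply: oppr_inj; rewrite e1 w1; ring.
  have ll' : l = l' by apply: (mulIf w1); move: e1 e1'; lra.
  apply: qp; move: e2 e3 e2' e3'; rewrite -ll' => <- <-.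
  by case: (p) (q) => [? ?] [? ?] /= /addIr -> /addIr ->.
have := @solutions_enum _ c r i j k (fun _ _ => [::]) [:: p; q] r0 cov.
apply=> [b b'|]; last first.
  apply: PE; apply/seteqP; split=> x; last by case=> ->.
  by move=> dx; rewrite -(E _ _ nij); split; exact: dx.
apply: contact_coaxial w0 _ => //.
- by apply: rel_neq0 => /inj/esym.
- by apply: rel_neq0 => /inj/esym.
- by apply: rel_neq => /inj.
- rewrite (lor3_nvec false) oppr_eq0 -[_ + _]/(sqd (c j) (c i)) sqdC.
  exact: nt nij.
Qed.

Lemma classified_has_double :
  [/\ exists! i : 'I_17, falls_into (circles c r) (tnth apollonius_cases i),
      forall k : kind, of_kind (circles c r) k ->
        exists i : 'I_17, case_kind (tnth apollonius_cases i) = k /\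
          falls_into (circles c r) (tnth apollonius_cases i)
    & forall i : 'I_17, falls_into (circles c r) (tnth apollonius_cases i) ->
        has_number (solutions (circles c r))
          (case_N (tnth apollonius_cases i))].
Proof.
have cov3 i j k : i <> j -> i <> k -> j <> k -> triple_cover i j k.
  by move=> /eqP ? /eqP ? /eqP ?; exact: triple_coverP.
have [q12|q12] := boolP (tang c r o0 o1).
  have [q13|q13] := boolP (tang c r o0 o2).
    apply: classified_doubleP (double_three_tangencies cover012 q12 q13).
    by vm_compute.
  apply: classified_doubleP (double_one_tangency cover012 q12 q13).
  by vm_compute.
have [q13|q13] := boolP (tang c r o0 o2).
  have cov : triple_cover o0 o2 o1 by exact: cov3.
  apply: classified_doubleP (double_one_tangency cov q13 q12).
  by vm_compute.
have [q23|q23] := boolP (tang c r o1 o2).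
  have cov : triple_cover o1 o2 o0 by exact: cov3.
  rewrite tangC in q12.
  apply: classified_doubleP (double_one_tangency cov q23 q12).
  by vm_compute.
have [[q [dq qp]]|nq] :=
    pselect (exists q, double_points (circles c r) q /\ q <> p).
  apply: classified_doubleP (double_two_points cover012 qp dq).
  by vm_compute.
apply: classified_doubleP (double_four_points cover012 _ q12 q13 q23).
  by vm_compute.
by move=> q dq; apply: contrapT => qp; apply: nq; exists q.
Qed.

End DoublePoint.

(** * Arbitrary configurations and the possible numbers of solutions *)

Lemma configuration_circles (R : realType) (C : 'I_3 -> set (R * R)) :
  configuration C -> exists c r, [/\ forall i, 0 < r i,
    injective (fun i => (c i, r i)) & C = circles c r].
Proof.
move=> [Cc Ci].
have /choice[f fP] : forall i, exists x : (R * R) * R,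
    0 < x.2 /\ C i = circ x.1 x.2.
  by move=> i; have [c [r [r0 E]]] := Cc i; exists (c, r).
exists (fun i => (f i).1), (fun i => (f i).2).
have CE : C = circles (fun i => (f i).1) (fun i => (f i).2).
  by apply/funext => i; exact: (fP i).2.
split=> // [i|i j [e1 e2]]; first exact: (fP i).1.
by apply: Ci; rewrite CE /circles e1 e2.
Qed.

Lemma classified_configuration (R : realType) (C : 'I_3 -> set (R * R)) :
  configuration C ->
  [/\ exists! i : 'I_17, falls_into C (tnth apollonius_cases i),
      forall k : kind, of_kind C k ->
        exists i : 'I_17, case_kind (tnth apollonius_cases i) = k /\
          falls_into C (tnth apollonius_cases i)
    & forall i : 'I_17, falls_into C (tnth apollonius_cases i) ->
        has_number (solutions C) (case_N (tnth apollonius_cases i))].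
Proof.
move=> /configuration_circles[c [r [r0 inj ->]]].
have [[p dp]|nod] := pselect (has_double_points (circles c r)).
  by apply: (classified_has_double r0 inj dp).
exact: classified_no_double.
Qed.

Lemma has_number_inj (T : Type) (A : set T) (m : nat) (N : option nat) :
  has_number A (Some m) -> has_number A N -> N = Some m.
Proof.
case: N => [n|] /= Am An.
  by congr Some; apply/card_eq_II; apply: card_eq_trans Am; rewrite card_eq_sym.
by exfalso; apply: An; apply/finite_setP; exists m.
Qed.

Lemma finite_number_cases (R : realType) (C : 'I_3 -> set (R * R)) (m : nat) :
  configuration C -> has_number (solutions C) (Some m) ->
  m \in [:: 0; 2; 3; 4; 5; 6; 8]%N.
Proof.
move=> /classified_configuration[[i [iP _]] _ /(_ i iP)] NP mP.
have E := has_number_inj mP NP.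
have : all (fun x => if case_N x is Some n
    then n \in [:: 0; 2; 3; 4; 5; 6; 8]%N else true) apollonius_cases.
  by vm_compute.
by move=> /all_tnthP/(_ i); rewrite E.
Qed.

Lemma exists_eight_solutions (R : realType) :
  exists C : 'I_3 -> set (R * R),
    configuration C /\ has_number (solutions C) (Some 8%N).
Proof.
(* Unit circles with centers 4 apart on a line are mutually exterior: all gaps are negative, so each
   of the four orientation pairs gives two solutions. *)
pose c (i : 'I_3) : R * R := (4 * (val i)%:R, 0); pose r (i : 'I_3) : R := 1.
have r0 i : 0 < r i by exact: ltr01.
have inj : injective (fun i => (c i, r i)).
  move=> i j [] /mulfI h; apply: ord_inj; apply/eqP.
  by rewrite -(eqr_nat R); apply/eqP/h; rewrite pnatr_eq0.
exists (circles c r); split.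
  split=> [i|i j /(circ_inj (r0 i) (r0 j))[cE _]].
    exact: is_circle_circ.
  by apply: inj; rewrite cE.
have gt i j : i <> j -> gapij c r true i j < 0.
  move=> ij; rewrite /gapij /gapc /gap /sqd /c /r /= subrr expr0n addr0.
  rewrite -mulrBr exprMn subr_lt0.
  have : 1 <= ((val i)%:R - (val j)%:R : R) ^+ 2.
    rewrite -real_normK ?num_real // expr_ge1 //.
    case: (ltngtP (val i) (val j)) => [h|h|/val_inj //].
      by rewrite distrC -natrB ?(ltnW h) // normr_nat ler1n subn_gt0.
    by rewrite -natrB ?(ltnW h) // normr_nat ler1n subn_gt0.
  lra.
have gf i j : i <> j -> gapij c r false i j < 0.
  by move=> ij; apply: lt_trans (gt _ _ ij); exact: gap_lt.
have nod : ~ has_double_points (circles c r).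
  (* A common point would make the product of the two gaps nonpositive, but both are negative. *)
  move=> [p dp]; have := gap_area r0 dp o0 o1.
  have h : 0 < gapij c r false o0 o1 * gapij c r true o0 o1.
    by rewrite nmulr_rgt0 // ?gf ?gt.
  by move=> e; move: h; rewrite e oppr_gt0 ltNge sqr_ge0.
have gl b i j : i <> j -> gapij c r b i j < 0 by case: b; [exact: gt|exact: gf].
have := solutions_no_double r0 inj cover012 nod.
have nE b b' : nsol c r o0 o1 o2 b b' = 2%N.
  have h : 0 < - (gapij c r b o0 o1 * gapij c r b' o0 o2 *
      gapij c r (b (+) b') o1 o2).
    by rewrite oppr_gt0 nmulr_llt0 ?gl // nmulr_rgt0 ?gl.
  by rewrite /nsol /nroots h ltW.
by rewrite !nE.
Qed.

Theorem mainTheorem1 (R : realType) :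
  (forall C : 'I_3 -> set (R * R), configuration C ->
    [/\ exists! i : 'I_17, falls_into C (tnth apollonius_cases i),
        forall k : kind, of_kind C k ->
          exists i : 'I_17, case_kind (tnth apollonius_cases i) = k /\
            falls_into C (tnth apollonius_cases i)
      & forall i : 'I_17, falls_into C (tnth apollonius_cases i) ->
          has_number (solutions C) (case_N (tnth apollonius_cases i))])
  /\ (exists C : 'I_3 -> set (R * R),
        configuration C /\ has_number (solutions C) (Some 8%N))
  /\ (forall (C : 'I_3 -> set (R * R)) (m : nat), configuration C ->
        has_number (solutions C) (Some m) -> (m <= 8)%N)
  /\ (~ exists C : 'I_3 -> set (R * R),
        configuration C /\ has_number (solutions C) (Some 7%N))
  /\ (~ exists C : 'I_3 -> set (R * R),
        configuration C /\ has_number (solutions C) (Some 1%N)).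
Proof.
split; first exact: classified_configuration.
split; first exact: exists_eight_solutions.
split.
  move=> C m Cc /(finite_number_cases Cc); rewrite !inE.
  by do 6![case/orP => [/eqP -> //|]] => /eqP ->.
by split=> -[C [Cc /(finite_number_cases Cc)]].
Qed.
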